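(* Consider online combinatorial optimization with semi-bandit feedback over $T$ rounds with decision set $\mathcal{S}\subseteq\{0,1\}^d$ satisfying $\|\boldsymbol v\|_1\le m$ for all $\boldsymbol v\in\mathcal S$, against a non-oblivious environment. For every $\eta>0$ and every positive integer $M$, the expected regret of the algorithm FPL+GR run with parameters $\eta$ and $M$ satisfies $$\widehat R_T \le \frac{m\left(\log(d/m)+1\right)}{\eta}+2\eta m d T+\frac{dT}{eM}.$$ In particular, with $$\eta=\sqrt{\frac{\log(d/m)+1}{2dT}}\qquad\text{and}\qquad M=\left\lceil\frac{\sqrt{dT}}{em\sqrt{2(\log(d/m)+1)}}\right\rceil,$$ the expected regret of FPL+GR is bounded as $$\widehat R_T\le 3m\sqrt{2dT\left(\log\frac dm+1\right)}.$$
   Context: **Problem.** Let $1\le m\le d$ and $T\ge1$ be integers and let $\mathcal S\subseteq\{0,1\}^d$ be a nonempty finite set with $\|\boldsymbol v\|_1\le m$ for all $\boldsymbol v\in\mathcal S$. In each round $t=1,\dots,T$ the learner draws a random action $\boldsymbol V_t\in\mathcal S$, the environment chooses a loss vector $\boldsymbol\ell_t\in[0,1]^d$, and the learner suffers loss $\boldsymbol V_t^{\mathsf T}\boldsymbol\ell_t$. The environment is non-oblivious: $\boldsymbol\ell_t$ may depend in an arbitrary fashion on the previous actions $\boldsymbol V_1,\dots,\boldsymbol V_{t-1}$ (but not on the learner's randomness in round $t$). Semi-bandit feedback: the learner observes $\ell_{t,i}$ only for those $i$ with $V_{t,i}=1$. **Expected regret.** $$\widehat R_T=\max_{\boldsymbol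 v\in\mathcal S}\mathbb E\Big[\sum_{t=1}^T(\boldsymbol V_t-\boldsymbol v)^{\mathsf T}\boldsymbol\ell_t\Big].$$ **Algorithm FPL+GR with parameters $\eta>0$, $M\in\{1,2,\dots\}$.** Start with $\widehat{\boldsymbol L}_0=\boldsymbol 0\in\mathbb R^d$. In round $t$: 1. Draw $\boldsymbol Z_t\in\mathbb R^d$, independent of the past, with i.i.d. standard (unit mean) exponential components, and play $\boldsymbol V_t=\arg\min_{\boldsymbol v\in\mathcal S}\boldsymbol v^{\mathsf T}(\eta\widehat{\boldsymbol L}_{t-1}-\boldsymbol Z_t)$ (the minimizer is almost surely unique). 2. (Geometric Resampling) For $k=1,\dots,M$ draw fresh independent copies $\boldsymbol Z_t'(k)$ of $\boldsymbol Z_t$ and set $\boldsymbol V_t'(k)=\arg\min_{\boldsymbol v\in\mathcal S}\boldsymbol v^{\mathsf T}(\eta\widehat{\boldsymbol L}_{t-1}-\boldsymbol Z'_t(k))$. For $i=1,\dots,d$ let $K_{t,i}=\min\big(\{k\in\{1,\dots,M\}: V'_{t,i}(k)=1\}\cup\{M\}\big)$. 3. Set $\widehat\ell_{t,i}=K_{t,i}V_{t,i}\ell_{t,i}$ for all $i$ and $\widehat{\boldsymbol L}_t=\widehat{\boldsymbol L}_{t-1}+\widehat{\boldsymbol\ell}_t$. *)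

(* Defs.v *)
From HB Require Import structures.
From mathcomp Require Import all_boot all_order all_algebra finmap.
From mathcomp Require Import all_classical all_reals all_analysis.

Set Implicit Arguments.
Unset Strict Implicit.
Unset Printing Implicit Defensive.
Import Order.TTheory GRing.Theory Num.Theory.
Import numFieldNormedType.Exports.
Local Open Scope classical_set_scope.
Local Open Scope ring_scope.

(* Rounds and resamples are numbered from 0: index t stands for round t + 1 and
   index k for the resample k + 1. *)

Notation action d := {ffun 'I_d -> bool}.

Definition l1norm d (v : action d) : nat := (\sum_(i < d) v i)%N.

Definition dot (R : realType) d (v : action d) (x : 'I_d -> R) : R :=
  \sum_(i < d) (v i)%:R * x i.

Section Algorithm.
Variables (R : realType) (d : nat) (S : {set action d}) (eta : R) (M : nat).

(* Ties, which have probability zero below, are broken by a fixed rule. The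
   minimum is over S only when S is nonempty. *)
Definition argmin_dot (x : 'I_d -> R) : action d :=
  [arg min_(v < odflt [ffun=> false] [pick v in S] in S) dot v x]%O.

Definition perturbed_leader (L z : 'I_d -> R) : action d :=
  argmin_dot (fun i => eta * L i - z i).

(* min ({k in {1..M} : V'_i(k) = 1} U {M}) *)
Definition geometric_resampling (L : 'I_d -> R) (z' : nat -> 'I_d -> R)
    (i : 'I_d) : nat :=
  \big[minn/M]_(k < M | perturbed_leader L (z' k) i) k.+1.

(* One realization of the protocol: z t and z' t k are the perturbations drawn
   in a round, and loss maps the sequence of all previous actions, oldest first,
   to the current loss vector. The state after t rounds is that sequence of
   actions together with the cumulative loss estimate. *)
Variables (z : nat -> 'I_d -> R) (z' : nat -> nat -> 'I_d -> R)
  (loss : seq (action d) -> 'I_d -> R).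

Fixpoint fpl_gr_state (t : nat) : seq (action d) * ('I_d -> R) :=
  if t is s.+1 then
    let: (h, L) := fpl_gr_state s in
    let v := perturbed_leader L (z s) in
    (rcons h v,
     fun i => L i + (geometric_resampling L (z' s) i)%:R * (v i)%:R * loss h i)
  else ([::], fun=> 0).

Definition fpl_gr_action (t : nat) : action d :=
  perturbed_leader (fpl_gr_state t).2 (z t).

Definition fpl_gr_loss (t : nat) : 'I_d -> R := loss (fpl_gr_state t).1.

End Algorithm.

Definition mutually_independent dO (Omega : measurableType dO) (R : realType)
    (P : probability Omega R) (I : choiceType) (D : set I)
    (F : I -> set (set Omega)) : Prop :=
  forall J : {fset I}, [set` J] `<=` D ->
  forall A : I -> set Omega, (forall i, i \in J -> F i (A i)) ->
  P (\bigcap_(i in [set` J]) A i) = (\prod_(i <- J) P (A i))%E.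

Definition sigma_of dO dE (Omega : measurableType dO) (E : measurableType dE)
    (X : Omega -> E) : set (set Omega) :=
  preimage_set_system [set: Omega] X measurable.

(* Labels of the random elements of a run: the private randomness of the
   environment, the perturbations (t, i) used to play, and the perturbations
   (t, k, i) used for resampling. *)
Notation source_label d :=
  (unit + nat * 'I_d + nat * nat * 'I_d)%type.

Definition used_label d (T M : nat) : set (source_label d) :=
  [set j | match j with
           | inl (inl _) => True
           | inl (inr (t, _)) => (t < T)%N
           | inr (t, k, _) => (t < T)%N /\ (k < M)%N
           end].

Definition source_sigma dO dE (Omega : measurableType dO)
    (E : measurableType dE) (R : realType) (P : probability Omega R) d
    (W : Omega -> E) (Z : nat -> 'I_d -> {RV P >-> R})
    (Z' : nat -> nat -> 'I_d -> {RV P >-> R})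
    (j : source_label d) : set (set Omega) :=
  match j with
  | inl (inl _) => sigma_of W
  | inl (inr (t, i)) => sigma_of (Z t i)
  | inr (t, k, i) => sigma_of (Z' t k i)
  end.

Definition std_exponential dO (Omega : measurableType dO) (R : realType)
    (P : probability Omega R) (X : {RV P >-> R}) : Prop :=
  forall B : set R, measurable B -> distribution P X B = exponential_prob 1 B.

Definition expected_regret dO (Omega : measurableType dO) (R : realType)
    (P : probability Omega R) d (S : {set action d})
    (V : nat -> Omega -> action d) (l : nat -> Omega -> 'I_d -> R) (T : nat) :
    \bar R :=
  (\big[maxe/-oo]_(v in S)
    'E_P[(fun w => \sum_(t < T)
            \sum_(i < d) ((V t w i)%:R - (v i)%:R) * l t w i)%R])%E.

(* The environment env receives its private random element W w and the previous
   actions. *)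
Definition fpl_gr_expected_regret dO dE (Omega : measurableType dO)
    (E : measurableType dE) (R : realType) (P : probability Omega R) d
    (S : {set action d}) (eta : R) (M : nat)
    (W : Omega -> E) (env : E -> seq (action d) -> 'I_d -> R)
    (Z : nat -> 'I_d -> {RV P >-> R}) (Z' : nat -> nat -> 'I_d -> {RV P >-> R})
    (T : nat) : \bar R :=
  let z w t i := Z t i w in
  let z' w t k i := Z' t k i w in
  expected_regret P S
    (fun t w => fpl_gr_action S eta M (z w) (z' w) (env (W w)) t)
    (fun t w => fpl_gr_loss S eta M (z w) (z' w) (env (W w)) t) T.

(* Main.v *)
Require Import Defs.
From HB Require Import structures.
From mathcomp Require Import all_boot all_order all_algebra finmap.
From mathcomp Require Import all_classical all_reals all_analysis.
From mathcomp Require Import measurable_realfun.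
From mathcomp Require Import ring lra.

(* Conditionally on the past, the played action V and the M resamples are M + 1
   independent draws from the same law p(L) on S, where L is the current estimate.
   Hence the truncated geometric variable K_i has P(K_i > n) = (1 - q_i)^n for
   n < M, with q_i the marginal of p(L). The loss estimate then has mean
   (1 - (1 - q_i)^M) l_i, whose bias costs q_i (1 - q_i)^M <= 1/(e M) per
   coordinate, and q_i^2 E[K_i^2] <= 2 gives the variance term 2 m d.

   The regret splits into the cost of playing V(L_t) instead of V(L_{t+1}), and
   the regret of the latter on the estimated losses. For the first, memorylessness
   of the exponential law gives p(L + x)(v) >= exp(- eta v.x) p(L)(v). The second
   depends only on the marginal laws p(L_{t+1}), so one perturbation z may be used
   in all rounds; the be-the-leader lemma bounds it by the maximum of v.z over S,
   divided by eta, and v.z <= m c + \sum_i (z_i - c)^+ with c = ln(d/m) has mean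
   at most m (ln(d/m) + 1).

   Once the private randomness of the environment is fixed (by Fubini), the
   history is a finite-valued process whose law is an explicit product, so that
   all conditional expectations become finite sums. *)

Set Implicit Arguments.
Unset Strict Implicit.
Unset Printing Implicit Defensive.
Import Order.TTheory GRing.Theory Num.Theory.
Import numFieldNormedType.Exports.
Local Open Scope classical_set_scope.
Local Open Scope ring_scope.

(** * One round with a fixed action distribution *)

Lemma mulr_expRN_le (R : realType) (x : R) : x * expR (- x) <= (expR 1)^-1.
Proof.
rewrite expRN ler_pdivrMr ?expR_gt0// -expRN -expRD addrC.
by have := expR_ge1Dx (x - 1); rewrite [1 + _]addrC subrK.
Qed.

(** Since [1 - q <= expR (- q)], the left side is at most [q * expR (- (M q))], and [x * expR (- x)]
    never exceeds [1 / e]; take [x = M q]. *)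
Lemma mulr_1BX_le (R : realType) (q : R) (M : nat) : 0 <= q <= 1 -> (0 < M)%N ->
  q * (1 - q) ^+ M <= (expR 1 * M%:R)^-1.
Proof.
move=> /andP[q0 q1] M0.
have M0' : 0 < M%:R :> R by rewrite ltr0n.
rewrite invfM ler_pdivlMr//.
apply: le_trans (mulr_expRN_le (M%:R * q)).
rewrite mulrAC (mulrC q) ler_wpM2l ?mulr_ge0//.
rewrite -mulrN mulrC expRM_natr lerXn2r// ?nnegrE ?subr_ge0 ?expR_ge0//.
exact: expR_ge1Dx.
Qed.

(** The resampling count as a function of the finite table of resampled actions, so that its law
    becomes a finite sum. The default [M] of the minimum is the truncation. *)
Definition first_hit d M (w : {ffun 'I_M -> action d}) (i : 'I_d) : nat :=
  \big[minn/M]_(k < M | w k i) k.+1.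

Lemma ltn_first_hit d M (w : {ffun 'I_M -> action d}) i n : (n < M)%N ->
  (n < first_hit w i)%N = [forall k : 'I_M, (k < n)%N ==> ~~ w k i].
Proof.
move=> nM; rewrite /first_hit.
rewrite (big_morph (leq n.+1) (id1 := true) (op1 := andb)) //; last first.
  by move=> x y; rewrite leq_min.
rewrite big_andE; apply: eq_forallb => k.
by rewrite ltnS leqNgt; case: (w k i); case: (k < n)%N.
Qed.

Lemma first_hit_le d M (w : {ffun 'I_M -> action d}) i : (first_hit w i <= M)%N.
Proof.
apply: (big_ind (fun x => x <= M)%N) => // x y xM _.
by rewrite geq_min xM.
Qed.

(** Telescoping up to [k]. Applied to a random [k], it reduces every expectation of [f k] to the
    tail probabilities of [k]. *)
Lemma layer_cake (R : zmodType) (f : nat -> R) (M k : nat) : (k <= M)%N ->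
  f k = f 0%N + \sum_(n < M) (f n.+1 - f n) *+ (n < k)%N.
Proof.
move=> kM; rewrite -[LHS](subrK (f 0%N)) addrC; congr (_ + _).
rewrite -telescope_sumr// big_mkord (big_ord_widen _ (fun n => f n.+1 - f n) kM).
by rewrite big_mkcond; apply: eq_bigr => n _; case: ltnP.
Qed.

Section IidActions.
Variables (R : realType) (d M : nat) (p : action d -> R).
Hypothesis p_ge0 : forall v, 0 <= p v.
Hypothesis p_sum1 : \sum_v p v = 1.

Definition marginal (i : 'I_d) : R := \sum_v p v * (v i)%:R.

Definition iid_weight (w : {ffun 'I_M -> action d}) : R := \prod_k p (w k).

Lemma marginal_ge0 i : 0 <= marginal i.
Proof. by apply: sumr_ge0 => v _; rewrite mulr_ge0. Qed.

Lemma marginal_le1 i : marginal i <= 1.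
Proof.
rewrite -p_sum1; apply: ler_sum => v _.
by rewrite ler_piMr//; case: (v i).
Qed.

Lemma iid_weight_ge0 w : 0 <= iid_weight w.
Proof. exact: prodr_ge0. Qed.

Lemma sum_iid_prod (f : 'I_M -> action d -> R) :
  \sum_w iid_weight w * (\prod_k f k (w k)) = \prod_k \sum_v p v * f k v.
Proof.
rewrite (bigA_distr_bigA (fun k v => p v * f k v)) /=.
by apply: eq_bigr => w _; rewrite -big_split.
Qed.

Lemma sum_iid_weight : \sum_w iid_weight w = 1.
Proof.
transitivity (\sum_w iid_weight w * \prod_(k < M) (1 : R)).
  by apply: eq_bigr => w _; rewrite big1// mulr1.
rewrite (sum_iid_prod (fun _ _ => 1)) big1// => k _.
by rewrite -[RHS]p_sum1; apply: eq_bigr => v _; rewrite mulr1.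
Qed.

Lemma first_hit_tail i n : (n < M)%N ->
  \sum_w iid_weight w * (n < first_hit w i)%:R = (1 - marginal i) ^+ n.
Proof.
move=> nM.
(* The event that the count exceeds [n] is a product over resamples: the first [n] must miss [i],
   the others are free. Each of the first [n] factors averages to [1 - marginal i]. *)
pose f (k : 'I_M) (v : action d) : R := if (k < n)%N then (~~ v i)%:R else 1.
transitivity (\sum_w iid_weight w * \prod_k f k (w k)).
  apply: eq_bigr => w _; congr (_ * _); rewrite ltn_first_hit//.
  case: (boolP [forall k : 'I_M, _]) => [/forallP h|/forallPn[k]].
    rewrite big1// => k _; rewrite /f; case: ifPn => // kn.
    by have := h k; rewrite kn => /= ->.
  rewrite negb_imply negbK => /andP[kn wki].
  by rewrite (bigD1 k)//= /f kn wki mul0r.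
rewrite sum_iid_prod; transitivity (\prod_(k < n) (1 - marginal i)); last first.
  by rewrite prodr_const card_ord.
rewrite (big_ord_widen _ (fun=> 1 - marginal i) (ltnW nM)) [RHS]big_mkcond.
apply: eq_bigr => k _; rewrite /f; case: ifPn => _.
  rewrite -[X in X - _]p_sum1 /marginal -sumrB; apply: eq_bigr => v _.
  by case: (v i); rewrite /= ?mulr0n ?mulr1n; ring.
by rewrite -[RHS]p_sum1; apply: eq_bigr => v _; rewrite mulr1.
Qed.

Lemma first_hit_expectation i (f : nat -> R) :
  \sum_w iid_weight w * f (first_hit w i) =
  f 0%N + \sum_(n < M) (f n.+1 - f n) * (1 - marginal i) ^+ n.
Proof.
under eq_bigr => w _ do
  rewrite (layer_cake f (first_hit_le w i)) mulrDr mulr_sumr.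
rewrite big_split/= -mulr_suml sum_iid_weight mul1r; congr (_ + _).
rewrite exchange_big/=; apply: eq_bigr => n _.
rewrite -first_hit_tail// mulr_sumr; apply: eq_bigr => w _.
by rewrite [RHS]mulrCA mulr_natr.
Qed.

(** A telescoping geometric sum. Multiplying by the marginal instead of dividing by it keeps the
    identity valid when the marginal vanishes. *)
Lemma first_hit_mean i :
  marginal i * (\sum_w iid_weight w * (first_hit w i)%:R) =
  1 - (1 - marginal i) ^+ M.
Proof.
rewrite (first_hit_expectation i (fun n => n%:R)) add0r.
elim: M => [|k IH]; first by rewrite big_ord0 expr0; ring.
by rewrite big_ord_recr /= mulrDr IH exprS -(natr1 k); ring.
Qed.

Lemma first_hit_sqr i :
  marginal i ^+ 2 * (\sum_w iid_weight w * (first_hit w i)%:R ^+ 2) <= 2.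
Proof.
rewrite (first_hit_expectation i (fun n => n%:R ^+ 2)) expr0n add0r.
have := marginal_ge0 i; have := marginal_le1 i; set q := marginal i => q1 q0.
(* Closed form of the sum of [(2 n + 1) (1 - q)^n] over [n < M], scaled by [q^2] and checked by
   induction on [M]; everything subtracted from 2 is nonnegative. *)
suff -> : q ^+ 2 * (\sum_(n < M) (n.+1%:R ^+ 2 - n%:R ^+ 2) * (1 - q) ^+ n) =
    2 - q - (1 - q) ^+ M * (2 * M%:R * q + 2 - q).
  have : 0 <= (1 - q) ^+ M by rewrite exprn_ge0// subr_ge0.
  have : 0 <= M%:R * q by rewrite mulr_ge0.
  nra.
elim: M => [|k IH]; first by rewrite big_ord0 expr0; ring.
by rewrite big_ord_recr /= mulrDr IH (exprS (1 - q) k) -(natr1 k); ring.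
Qed.

Section OneRound.
Variables (m : nat) (eta : R) (l : 'I_d -> R) (u : action d).
Hypothesis p_supp : forall v, p v != 0 -> (l1norm v <= m)%N.
Hypothesis eta_ge0 : 0 <= eta.
Hypothesis l01 : forall i, 0 <= l i <= 1.
Hypothesis M_gt0 : (0 < M)%N.

Definition loss_estimate (v : action d) (w : {ffun 'I_M -> action d}) i : R :=
  (first_hit w i)%:R * (v i)%:R * l i.

(** Expectation over one round: the played action [v] and the resamples [w] are independent draws
    from [p]. *)
Definition round_sum (f : action d -> {ffun 'I_M -> action d} -> R) : R :=
  \sum_v \sum_w p v * iid_weight w * f v w.

Lemma round_sum_le f g : (forall v w, p v != 0 -> f v w <= g v w) ->
  round_sum f <= round_sum g.
Proof.
move=> fg; apply: ler_sum => v _; apply: ler_sum => w _.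
have [->|pv] := eqVneq (p v) 0; first by rewrite !mul0r.
by rewrite ler_wpM2l ?fg// mulr_ge0 ?iid_weight_ge0.
Qed.

Lemma round_sumD f g :
  round_sum (fun v w => f v w + g v w) = round_sum f + round_sum g.
Proof.
rewrite -big_split; apply: eq_bigr => v _; rewrite -big_split/=.
by apply: eq_bigr => w _; rewrite mulrDr.
Qed.

Lemma round_sumZ c f : round_sum (fun v w => c * f v w) = c * round_sum f.
Proof.
rewrite mulr_sumr; apply: eq_bigr => v _; rewrite mulr_sumr.
by apply: eq_bigr => w _; rewrite mulrCA.
Qed.

Lemma round_sum_sum (I : finType) (f : I -> _ -> _ -> R) :
  round_sum (fun v w => \sum_i f i v w) = \sum_i round_sum (f i).
Proof.
rewrite /round_sum [RHS]exchange_big; apply: eq_bigr => v _.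
by rewrite [RHS]exchange_big; apply: eq_bigr => w _; rewrite mulr_sumr.
Qed.

Lemma round_sumM (f : action d -> R) (g : {ffun 'I_M -> action d} -> R) :
  round_sum (fun v w => f v * g w) =
  (\sum_v p v * f v) * (\sum_w iid_weight w * g w).
Proof.
rewrite mulr_suml; apply: eq_bigr => v _; rewrite mulr_sumr.
by apply: eq_bigr => w _; rewrite mulrACA.
Qed.

Lemma round_sum_cst c : round_sum (fun _ _ => c) = c.
Proof.
rewrite -[X in round_sum (fun _ _ => X)](mulr1 c).
rewrite (round_sumM (fun=> c) (fun=> 1)) -mulr_suml p_sum1 mul1r.
by under eq_bigr do rewrite mulr1; rewrite sum_iid_weight mulr1.
Qed.

Lemma round_sum_played i : round_sum (fun v _ => (v i)%:R) = marginal i.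
Proof.
under [LHS]eq_bigr => v _ do under eq_bigr => w _ do rewrite -(mulr1 (_%:R)).
rewrite [LHS](round_sumM (fun v => (v i)%:R) (fun=> 1)).
by under [X in _ * X]eq_bigr do rewrite mulr1; rewrite sum_iid_weight mulr1.
Qed.

Lemma round_sum_loss_estimate i :
  round_sum (fun v w => loss_estimate v w i) =
  (1 - (1 - marginal i) ^+ M) * l i.
Proof.
rewrite -first_hit_mean mulrC -[X in _ = _ * X]round_sumM -round_sumZ.
apply: eq_bigr => v _; apply: eq_bigr => w _; congr (_ * _).
by rewrite /loss_estimate; ring.
Qed.

(** The square is expanded into a double sum over coordinates, whose cross terms are split by the
    arithmetic-geometric mean inequality. One index is then summed freely over the support of [v],
    which has at most [m] elements. *)
Lemma sqr_dot_loss_estimate (a v : action d) w : (l1norm v <= m)%N ->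
  dot a (loss_estimate v w) ^+ 2 <=
  m%:R * \sum_i (a i)%:R * (v i)%:R * (first_hit w i)%:R ^+ 2.
Proof.
move=> vm; pose x i : R := (a i)%:R * (v i)%:R * (first_hit w i)%:R.
have x_ge0 i : 0 <= x i by rewrite !mulr_ge0.
apply: (@le_trans _ _ ((\sum_i x i) ^+ 2)).
  have le_x i : 0 <= (a i)%:R * loss_estimate v w i <= x i.
    have /andP[l0 l1] := l01 i.
    have -> : (a i)%:R * loss_estimate v w i = x i * l i.
      by rewrite /x /loss_estimate; ring.
    by rewrite mulr_ge0//= ler_piMr.
  rewrite lerXn2r ?nnegrE ?sumr_ge0// => [i _|]; first by have /andP[] := le_x i.
  by apply: ler_sum => i _; have /andP[] := le_x i.
rewrite expr2 mulr_suml.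
under eq_bigr do rewrite mulr_sumr.
pose y i : R := (a i)%:R * (v i)%:R * (first_hit w i)%:R ^+ 2.
have y_ge0 i : 0 <= y i by rewrite !mulr_ge0// exprn_ge0.
(* From [2 s t <= s^2 + t^2]. In each half one of the two [a] factors is bounded by 1, so that only
   [v] remains for the freed index. *)
have xx i j : x i * x j <= (y i * (v j)%:R + (v i)%:R * y j) / 2.
  rewrite /x /y; set s := (first_hit w i)%:R; set t := (first_hit w j)%:R.
  have := sqr_ge0 (s - t); have : 0 <= s by []. have : 0 <= t by [].
  by case: (a i); case: (v i); case: (a j); case: (v j) => /=; nra.
apply: (@le_trans _ _ (\sum_i \sum_j (y i * (v j)%:R + (v i)%:R * y j) / 2)).
  by apply: ler_sum => i _; apply: ler_sum => j _; exact: xx.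
have -> : \sum_i \sum_j (y i * (v j)%:R + (v i)%:R * y j) / 2 =
    (\sum_j (v j)%:R) * \sum_i y i :> R.
  under eq_bigr => i _ do rewrite -mulr_suml big_split/= -!mulr_sumr.
  by rewrite -mulr_suml big_split/= -!mulr_suml; field.
by rewrite ler_wpM2r ?sumr_ge0// -natr_sum ler_nat.
Qed.

(** Averaging over [a] and over the independent [v] turns each indicator into a marginal, so
    coordinate [i] contributes the squared marginal times the second moment of the count, at most 2
    by [first_hit_sqr]. *)
Lemma round_sum_sqr :
  round_sum (fun v w => \sum_a p a * dot a (loss_estimate v w) ^+ 2) <=
  2 * m%:R * d%:R.
Proof.
apply: (@le_trans _ _ (round_sum (fun v w =>
    m%:R * \sum_i marginal i * ((v i)%:R * (first_hit w i)%:R ^+ 2)))).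
  apply: round_sum_le => v w pv.
  under [X in _ <= _ * X]eq_bigr do rewrite mulr_suml.
  rewrite exchange_big mulr_sumr; apply: ler_sum => a _.
  have := sqr_dot_loss_estimate a w (p_supp pv) => /(ler_wpM2l (p_ge0 a)) /le_trans.
  apply; rewrite mulrCA ler_wpM2l// mulr_sumr.
  by apply: ler_sum => i _; rewrite !mulrA.
rewrite round_sumZ round_sum_sum -mulrA mulrCA ler_wpM2l//.
have -> : 2 * d%:R = \sum_(i < d) 2 :> R by rewrite sumr_const card_ord mulr_natr.
apply: ler_sum => i _; rewrite round_sumZ round_sumM mulrA -expr2.
exact: first_hit_sqr.
Qed.

(** Here [p'] stands for the leader law after the estimate has been updated by this round. The
    hypothesis, a linearized stability, lets [p] replace [p'] at the price of [eta] times the second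
    moment; what is left is the truncation bias, treated coordinatewise. *)
Lemma one_round (p' : action d -> {ffun 'I_M -> action d} -> action d -> R) :
  (forall v w a, p a * (1 - eta * dot a (loss_estimate v w)) <= p' v w a) ->
  round_sum (fun v w => dot v l - dot u l + dot u (loss_estimate v w)
                        - \sum_a p' v w a * dot a (loss_estimate v w)) <=
  2 * eta * m%:R * d%:R + d%:R / (expR 1 * M%:R).
Proof.
move=> p'_ge.
have le_ge0 v w i : 0 <= loss_estimate v w i.
  by have /andP[? _] := l01 i; rewrite !mulr_ge0.
have dot_ge0 a v w : 0 <= dot a (loss_estimate v w).
  by apply: sumr_ge0 => i _; rewrite mulr_ge0.
(* Coordinate [i] of the round cost once [p'] has been replaced by [p]. *)
pose bias (v : action d) (w : {ffun 'I_M -> action d}) i :=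
  (v i)%:R * l i - (u i)%:R * l i + ((u i)%:R - marginal i) * loss_estimate v w i.
apply: (@le_trans _ _ (round_sum (fun v w => \sum_i bias v w i
    + eta * \sum_a p a * dot a (loss_estimate v w) ^+ 2))).
  apply: round_sum_le => v w _.
  have le1 : \sum_a p a * dot a (loss_estimate v w)
       - eta * \sum_a p a * dot a (loss_estimate v w) ^+ 2 <=
      \sum_a p' v w a * dot a (loss_estimate v w).
    rewrite mulr_sumr -sumrB; apply: ler_sum => a _.
    have := ler_wpM2r (dot_ge0 a v w) (p'_ge v w a).
    by apply: le_trans; rewrite le_eqVlt; apply/orP; left; apply/eqP; ring.
  suff E : \sum_i bias v w i = dot v l - dot u l + dot u (loss_estimate v w) -
      \sum_a p a * dot a (loss_estimate v w) by rewrite E; lra.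
  rewrite /bias /dot.
  have -> : \sum_a p a * \sum_i (a i)%:R * loss_estimate v w i =
      \sum_i marginal i * loss_estimate v w i.
    under [RHS]eq_bigr do rewrite mulr_suml.
    rewrite exchange_big; apply: eq_bigr => a _; rewrite mulr_sumr.
    by apply: eq_bigr => i _; rewrite mulrA.
  rewrite -sumrB -big_split -sumrB/=; apply: eq_bigr => i _; ring.
rewrite round_sumD round_sumZ addrC lerD//.
  apply: (le_trans (ler_wpM2l eta_ge0 round_sum_sqr)).
  by rewrite le_eqVlt; apply/orP; left; apply/eqP; ring.
rewrite round_sum_sum.
have -> : d%:R / (expR 1 * M%:R) = \sum_(i < d) (expR 1 * M%:R)^-1 :> R.
  by rewrite sumr_const card_ord mulr_natl.
apply: ler_sum => i _.
have -> : round_sum (fun v w => bias v w i) = marginal i * l i - (u i)%:R * l i +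
    ((u i)%:R - marginal i) * ((1 - (1 - marginal i) ^+ M) * l i).
  transitivity (round_sum (fun v _ => l i * (v i)%:R)
      + (round_sum (fun _ _ => - ((u i)%:R * l i))
      + round_sum (fun v w => ((u i)%:R - marginal i) * loss_estimate v w i))).
    rewrite -!round_sumD; apply: eq_bigr => v _; apply: eq_bigr => w _.
    by congr (_ * _); rewrite /bias; ring.
  by rewrite !round_sumZ round_sum_cst round_sum_played round_sum_loss_estimate; ring.
have /andP[l0 l1] := l01 i.
have q0 := marginal_ge0 i; have q1 := marginal_le1 i.
have q01 : 0 <= marginal i <= 1 by rewrite q0.
apply: le_trans (mulr_1BX_le q01 M_gt0).
set b := (1 - marginal i) ^+ M.
have b0 : 0 <= b by rewrite exprn_ge0// subr_ge0.
have u0 : 0 <= (u i)%:R :> R by [].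
(* Truncation underestimates losses on average. For the comparator [u] this only lowers the
   expression, so its term is dropped; for the learner it leaves the bias [q (1 - q)^M]. *)
have -> : marginal i * l i - (u i)%:R * l i +
    ((u i)%:R - marginal i) * ((1 - b) * l i) =
    marginal i * b * l i - (u i)%:R * (b * l i) by ring.
have : 0 <= (u i)%:R * (b * l i) by rewrite !mulr_ge0.
have : marginal i * b * l i <= marginal i * b by rewrite ler_piMr// mulr_ge0.
lra.
Qed.

End OneRound.
End IidActions.

(** * Leaders and histories *)

Section Leader.
Variables (R : realType) (d : nat) (S : {set action d}).
Hypothesis S_neq0 : S != finset.set0.

Let v0 : action d := odflt [ffun=> false] [pick v in S].

Let v0S : v0 \in S.
Proof.
rewrite /v0; case: pickP => //= S0; case/set0Pn: S_neq0 => v.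
by have := S0 v; rewrite /= => ->.
Qed.

Let minimizer (x : 'I_d -> R) : pred (action d) :=
  [pred w | w \in S & [forall (u | u \in S), dot w x <= dot u x]].

Let argmin_dotE x : argmin_dot S x = odflt v0 (pick (minimizer x)).
Proof. by []. Qed.

Lemma argmin_dot_in (x : 'I_d -> R) : argmin_dot S x \in S.
Proof.
by rewrite /argmin_dot; case: Order.TotalTheory.arg_minP => //; exact: v0S.
Qed.

Lemma argmin_dot_le (x : 'I_d -> R) u : u \in S ->
  dot (argmin_dot S x) x <= dot u x.
Proof.
rewrite /argmin_dot; case: Order.TotalTheory.arg_minP; first exact: v0S.
by move=> v _; apply.
Qed.

(** Everything listed before [v] fails [P], hence fails the stronger [Q]. *)
Lemma ohead_filter_sub (A : eqType) (P Q : pred A) (s : seq A) v :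
  (forall w, Q w -> P w) -> Q v ->
  ohead [seq x <- s | P x] = Some v -> ohead [seq x <- s | Q x] = Some v.
Proof.
move=> QP Qv; elim: s => //= w s IH.
case: ifPn => [_ [wv]|nPw]; first by rewrite wv Qv.
by rewrite ifN//; apply: contra nPw; exact: QP.
Qed.

(* The tie-breaking rule takes the first minimizer in a fixed enumeration, so a
   chosen minimizer stays chosen when the other values increase, even with
   ties. *)
Lemma argmin_dot_stable (x y : 'I_d -> R) :
  dot (argmin_dot S x) y = dot (argmin_dot S x) x ->
  (forall u, dot u x <= dot u y) -> argmin_dot S y = argmin_dot S x.
Proof.
set v := argmin_dot S x => vE le_xy.
have vS : v \in S := argmin_dot_in x.
have v_min u : u \in S -> dot v x <= dot u x by exact: argmin_dot_le.
suff : pick (minimizer y) = Some v by rewrite argmin_dotE => ->.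
have : pick (minimizer x) = Some v.
  move: (erefl v); rewrite {1}/v argmin_dotE.
  case: pickP => [w _ /= ->//|/(_ v)] /=.
  rewrite /minimizer /= vS /= => /negbT/forallPn[u].
  by rewrite negb_imply => /andP[uS]; rewrite v_min.
rewrite /pick /enum_mem; apply: ohead_filter_sub.
  move=> w /andP[wS /forallP w_min]; apply/andP; split=> //.
  have wv : dot w y <= dot v y by have := w_min v; rewrite [v \in _]vS.
  apply/forallP => u; apply/implyP => uS.
  apply: (le_trans (le_xy w)); apply: (le_trans wv).
  by rewrite vE v_min.
apply/andP; split=> //; apply/forallP => u; apply/implyP => uS.
by rewrite vE; apply: (le_trans (v_min _ uS)).
Qed.

(** Lowering the perturbation by [eta * v * x] gives [v] exactly the objective value it has under
    the estimate [L + x], while any other action gets at most its value under [L + x]. Passing to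
    [L + x] thus only raises the competitors of [v]. *)
Lemma perturbed_leader_stable (eta : R) (L x z : 'I_d -> R) (v : action d) :
  0 <= eta -> (forall i, 0 <= x i) ->
  perturbed_leader S eta L (fun i => z i - eta * ((v i)%:R * x i)) = v ->
  perturbed_leader S eta (fun i => L i + x i) z = v.
Proof.
rewrite /perturbed_leader => eta0 x0 vE; rewrite -[RHS]vE.
apply: argmin_dot_stable; rewrite ?vE.
  apply: eq_bigr => i _; case: (v i); rewrite /= ?mulr1n ?mulr0n; ring.
move=> u; apply: ler_sum => i _; apply: ler_wpM2l => //.
have : 0 <= eta * x i by rewrite mulr_ge0.
by case: (v i); rewrite /= ?mulr1n ?mulr0n; lra.
Qed.

End Leader.

Lemma dotBr (R : realType) d (v : action d) (x y : 'I_d -> R) :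
  dot v (fun i => x i - y i) = dot v x - dot v y.
Proof. by rewrite /dot -sumrB; apply: eq_bigr => i _; rewrite mulrBr. Qed.

Lemma dotDr (R : realType) d (v : action d) (x y : 'I_d -> R) :
  dot v (fun i => x i + y i) = dot v x + dot v y.
Proof. by rewrite /dot -big_split; apply: eq_bigr => i _; rewrite mulrDr. Qed.

Lemma dotZr (R : realType) d (v : action d) c (x : 'I_d -> R) :
  dot v (fun i => c * x i) = c * dot v x.
Proof. by rewrite /dot mulr_sumr; apply: eq_bigr => i _; rewrite mulrCA. Qed.

(** The positive part of [z - c], enlarged to dominate [- z] as well. This makes [dot_overshoot]
    hold for every real [z]; the enlargement matters only for negative [z], a null event for
    exponential variables. *)
Definition overshoot (R : realType) (c z : R) : R :=
  Num.max 0 (Num.max (z - c) (- z)).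

Lemma dot_overshoot (R : realType) d m (v u : action d) (c : R) (z : 'I_d -> R) :
  0 <= c -> (l1norm v <= m)%N ->
  dot v z - dot u z <= m%:R * c + \sum_i overshoot c (z i).
Proof.
move=> c0 vm; apply: (@le_trans _ _ (\sum_i ((v i)%:R * c + overshoot c (z i)))).
  rewrite /dot -sumrB; apply: ler_sum => i _; rewrite /overshoot.
  have : 0 <= Num.max 0 (Num.max (z i - c) (- z i)) by rewrite le_max lexx.
  have : z i - c <= Num.max 0 (Num.max (z i - c) (- z i)).
    by rewrite !le_max lexx orbT.
  have : - z i <= Num.max 0 (Num.max (z i - c) (- z i)).
    by rewrite !le_max lexx !orbT.
  by case: (v i); case: (u i); rewrite /= ?mulr1n ?mulr0n; lra.
rewrite big_split/= -mulr_suml lerD2r ler_wpM2r//.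
by rewrite -natr_sum ler_nat.
Qed.

(** * Finite-valued histories and the be-the-leader bound *)

Definition outcome d M : Type := (action d * {ffun 'I_M -> action d})%type.

HB.instance Definition _ d M := Finite.on (outcome d M).

(* Histories list the outcomes of the rounds, newest first. *)
Section History.
Variables (R : realType) (d M : nat) (S : {set action d}) (eta : R).
Variable loss : seq (action d) -> 'I_d -> R.

Fixpoint history_state (a : seq (outcome d M)) : seq (action d) * ('I_d -> R) :=
  if a is o :: a' then
    let: (h, L) := history_state a' in
    (rcons h o.1, fun i => L i + loss_estimate (loss h) o.1 o.2 i)
  else ([::], fun=> 0).

Definition history_loss a := loss (history_state a).1.
Definition history_estimate a := (history_state a).2.

Lemma history_estimate_cons o a i : history_estimate (o :: a) i =
  history_estimate a i + loss_estimate (history_loss a) o.1 o.2 i.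
Proof.
by rewrite /history_estimate /history_loss /=; case: (history_state a).
Qed.

Definition round_outcome (L z : 'I_d -> R) (z' : nat -> 'I_d -> R) : outcome d M :=
  (perturbed_leader S eta L z,
   [ffun k : 'I_M => perturbed_leader S eta L (z' k)]).

Fixpoint history (z : nat -> 'I_d -> R) (z' : nat -> nat -> 'I_d -> R) t :=
  if t is s.+1 then
    let a := history z z' s in
    round_outcome (history_estimate a) (z s) (z' s) :: a
  else [::].

(** The algorithm depends on the perturbations only through the leaders they produce, so its state
    can be replayed from the list of outcomes. *)
Lemma fpl_gr_stateE z z' t :
  fpl_gr_state S eta M z z' loss t = history_state (history z z' t).
Proof.
elim: t => //= t ->; rewrite /history_estimate.
case: (history_state _) => h L /=; congr (_, _); apply/funext => i.
congr (_ + _ * _ * _); congr (_%:R); apply: eq_bigl => k.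
by rewrite ffunE.
Qed.

Fixpoint history_regret (u : action d) (a : seq (outcome d M)) : R :=
  if a is o :: a' then
    history_regret u a' + (dot o.1 (history_loss a') - dot u (history_loss a'))
  else 0.

Lemma fpl_gr_regretE (u : action d) z z' T :
  \sum_(t < T) \sum_(i < d)
    ((fpl_gr_action S eta M z z' loss t i)%:R - (u i)%:R)
     * fpl_gr_loss S eta M z z' loss t i = history_regret u (history z z' T).
Proof.
elim: T => [|T IH]; first by rewrite big_ord0.
rewrite big_ord_recr IH /=; congr (_ + _).
rewrite /dot -sumrB; apply: eq_bigr => i _.
by rewrite /fpl_gr_action /fpl_gr_loss fpl_gr_stateE mulrBl.
Qed.

(* The leader here already knows the estimate of the current round, and uses the
   same perturbation in all rounds. *)
Fixpoint foresight_loss (z : 'I_d -> R) (a : seq (outcome d M)) : R :=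
  if a is o :: a' then
    foresight_loss z a' + dot (perturbed_leader S eta (history_estimate a) z)
                              (loss_estimate (history_loss a') o.1 o.2)
  else 0.

Lemma foresight_loss_le m (c : R) z a (u : action d) :
  S != finset.set0 -> (forall v, v \in S -> (l1norm v <= m)%N) ->
  0 < eta -> 0 <= c -> u \in S ->
  foresight_loss z a <= dot u (history_estimate a)
    + (m%:R * c + \sum_i overshoot c (z i)) / eta.
Proof.
move=> S0 Sm eta0 c0 uS.
pose x a i := eta * history_estimate a i - z i.
(* By [dot_overshoot], [b] dominates [dot v z] for all [v] in [S], in particular for the initial
   leader. Its summand [dot u z] cancels at the end against the perturbation of [u]. *)
pose b := m%:R * c + \sum_i overshoot c (z i) + dot u z.
(* Be-the-leader by induction: the new leader pays the estimated loss of the round, and on the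
   previous objective it does no better than the previous minimizer. *)
have btl : eta * foresight_loss z a <= dot (argmin_dot S (x a)) (x a) + b.
  elim: a => [|o a IH].
    rewrite mulr0 /= dotBr /b.
    have -> : dot (argmin_dot S (x [::])) (fun i => eta * history_estimate [::] i) = 0.
      by rewrite /dot big1// => i _; rewrite /history_estimate/= !mulr0.
    have := dot_overshoot u z c0 (Sm _ (argmin_dot_in S0 (x [::]))).
    by rewrite /x; lra.
  rewrite [foresight_loss _ _]/= mulrDr -dotZr.
  rewrite -[perturbed_leader _ _ _ _]/(argmin_dot S (x (o :: a))).
  set v := argmin_dot S (x (o :: a)).
  have vS : v \in S := argmin_dot_in S0 _.
  have := argmin_dot_le S0 (x a) vS.
  have -> : dot v (x (o :: a)) = dot v (x a) +
      dot v (fun i => eta * loss_estimate (history_loss a) o.1 o.2 i).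
    rewrite -dotDr; apply: eq_bigr => i _; congr (_ * _).
    by rewrite /x history_estimate_cons; ring.
  by move: IH; lra.
have := argmin_dot_le S0 (x a) uS; rewrite [X in _ <= X -> _]dotBr dotZr => uL.
rewrite -ler_pdivlMl// in btl.
apply: (le_trans btl); rewrite ler_pdivrMl// mulrDr mulrCA divff ?gt_eqF// mulr1.
by rewrite /b; lra.
Qed.

Section Weights.
(* [p L v] stands for the probability that [v] is the perturbed leader for the
   cumulative estimate [L]. *)
Variable p : ('I_d -> R) -> action d -> R.
Hypothesis p_ge0 : forall L v, 0 <= p L v.
Hypothesis p_sum1 : forall L, \sum_v p L v = 1.

Definition outcome_weight (L : 'I_d -> R) (o : outcome d M) : R :=
  p L o.1 * iid_weight (p L) o.2.

Lemma outcome_weight_ge0 L o : 0 <= outcome_weight L o.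
Proof. by rewrite mulr_ge0// iid_weight_ge0. Qed.

Lemma sum_outcome_weight L (f : outcome d M -> R) :
  \sum_o outcome_weight L o * f o = round_sum (p L) (fun v w => f (v, w)).
Proof.
rewrite /round_sum pair_bigA/=.
by apply: eq_bigr => -[v w] _.
Qed.

Fixpoint history_weight (a : seq (outcome d M)) : R :=
  if a is o :: a' then
    history_weight a' * outcome_weight (history_estimate a') o
  else 1.

Lemma history_weight_ge0 a : 0 <= history_weight a.
Proof. by elim: a => //= o a IH; rewrite mulr_ge0// outcome_weight_ge0. Qed.

Fixpoint histories n : seq (seq (outcome d M)) :=
  if n is k.+1 then [seq o :: a | a <- histories k, o <- enum {: outcome d M}]
  else [:: [::]].

Lemma big_histories n (f : seq (outcome d M) -> R) :
  \sum_(a <- histories n.+1) f a = \sum_(a <- histories n) \sum_o f (o :: a).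
Proof.
rewrite /= big_allpairs_dep; apply: eq_bigr => a _.
by rewrite big_enum.
Qed.

Lemma mem_histories n a : (a \in histories n) = (size a == n).
Proof.
elim: n a => [|n IH] [|o a] //=.
  by apply/negbTE/negP => /allpairsP[[b o]] [].
rewrite eqSS -IH; apply/allpairsP/idP => [[[b o'] /= [bn _ [_ ->]]]//|an].
by exists (a, o); rewrite mem_enum.
Qed.

Lemma uniq_histories n : uniq (histories n).
Proof.
elim: n => //= n IH; apply: allpairs_uniq => //; first exact: enum_uniq.
by move=> [a o] [b o'] _ _ /= [-> ->].
Qed.

Lemma sum_history_weight n : \sum_(a <- histories n) history_weight a = 1.
Proof.
elim: n => [|n IH]; first by rewrite big_seq1.
rewrite big_histories -[RHS]IH; apply: eq_bigr => a _ /=.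
rewrite -mulr_sumr -[RHS]mulr1; congr (_ * _).
transitivity (\sum_o outcome_weight (history_estimate a) o * 1).
  by apply: eq_bigr => o _; rewrite mulr1.
by rewrite sum_outcome_weight round_sum_cst.
Qed.

Variable u : action d.

Let foresight_gain a o :=
  \sum_v p (history_estimate (o :: a)) v
         * dot v (loss_estimate (history_loss a) o.1 o.2).

(** The mean of [foresight_loss] over the perturbation for a fixed history. Only the law of the
    leader in each single round enters, so how the perturbations of different rounds are coupled is
    immaterial. *)
Fixpoint mean_foresight_loss (a : seq (outcome d M)) : R :=
  if a is o :: a' then mean_foresight_loss a' + foresight_gain a' o else 0.

Variables (m : nat) (b : R).
Hypothesis eta_ge0 : 0 <= eta.
Hypothesis M_gt0 : (0 < M)%N.
Hypothesis p_supp : forall L v, p L v != 0 -> (l1norm v <= m)%N.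
Hypothesis p_stable : forall L x v, (forall i, 0 <= x i) ->
  p L v * (1 - eta * dot v x) <= p (fun i => L i + x i) v.
Hypothesis loss01 : forall h i, 0 <= loss h i <= 1.
Hypothesis foresight_le : forall a,
  mean_foresight_loss a <= dot u (history_estimate a) + b.

Lemma history_mean_regret n :
  \sum_(a <- histories n) history_weight a * history_regret u a <=
  b + n%:R * (2 * eta * m%:R * d%:R + d%:R / (expR 1 * M%:R)).
Proof.
set C := _ + d%:R / _.
(* Adding the estimated loss of [u] makes this quantity additive over rounds, with increments of
   conditional mean at most [C] by [one_round]; [foresight_le] then turns it into a bound on the
   regret. *)
pose excess a :=
  history_regret u a - mean_foresight_loss a + dot u (history_estimate a).
suff excess_le : \sum_(a <- histories n) history_weight a * excess a <= n%:R * C.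
  apply: (@le_trans _ _ (\sum_(a <- histories n) history_weight a * (b + excess a))).
    apply: ler_sum => a _; apply: ler_wpM2l; first exact: history_weight_ge0.
    by rewrite /excess; have := foresight_le a; lra.
  under eq_bigr do rewrite mulrDr.
  by rewrite big_split/= -mulr_suml sum_history_weight mul1r lerD2l.
elim: n => [|n IH].
  rewrite big_seq1 mul0r /excess /= /dot big1 ?subrr ?addr0 ?mulr0// => i _.
  by rewrite /history_estimate/= mulr0.
rewrite big_histories -natr1 mulrDl mul1r.
apply: (@le_trans _ _ (\sum_(a <- histories n)
    (history_weight a * excess a + history_weight a * C))); last first.
  by rewrite big_split/= -mulr_suml sum_history_weight mul1r lerD2r.
apply: ler_sum => a _; rewrite -mulrDr.
under eq_bigr => o _ do rewrite [history_weight _]/= -mulrA.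
rewrite -mulr_sumr; apply: ler_wpM2l; first exact: history_weight_ge0.
set L := history_estimate a; set l := history_loss a.
pose gain o := dot o.1 l - dot u l + dot u (loss_estimate l o.1 o.2)
  - foresight_gain a o.
have -> : \sum_o outcome_weight L o * excess (o :: a) =
    excess a + \sum_o outcome_weight L o * gain o.
  rewrite -[X in _ = X + _](round_sum_cst M (p_sum1 L)).
  rewrite -(sum_outcome_weight L (fun=> excess a)) -big_split/=.
  apply: eq_bigr => o _; rewrite -mulrDr; congr (_ * _).
  rewrite /excess /gain /= -/l.
  have -> : dot u (history_estimate (o :: a)) =
      dot u L + dot u (loss_estimate l o.1 o.2).
    by rewrite -dotDr; apply: eq_bigr => i _; rewrite history_estimate_cons.
  ring.
rewrite lerD2l sum_outcome_weight.
apply: (@one_round R d M (p L) (p_ge0 L) (p_sum1 L) m eta l u _ eta_ge0 _ M_gt0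
  (fun v w => p (history_estimate ((v, w) :: a)))); [exact: p_supp|exact: loss01|].
move=> v w c; have := @p_stable L (loss_estimate l v w) c.
have -> : (fun i => L i + loss_estimate l v w i) = history_estimate ((v, w) :: a).
  by apply/funext => i; rewrite history_estimate_cons.
apply=> i; have /andP[? _] := loss01 (history_state a).1 i.
by rewrite !mulr_ge0.
Qed.

End Weights.
End History.

(** * Laws on finite products and exponential variables *)

Lemma measurable_preimage d d' (T : measurableType d) (U : measurableType d')
    (f : T -> U) (B : set U) :
  measurable_fun setT f -> measurable B -> measurable (f @^-1` B).
Proof. by move=> mf mB; rewrite -[X in measurable X]setTI; exact: mf. Qed.

(** Both sides are finite measures in [A] that agree on the pi-system [G]. The factor [c] serves two
    purposes: [expR (- a)] for memorylessness, and the probability of [Q] for independence. *)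
Lemma scaled_law_unique d d' (R : realType) (T : measurableType d)
    (U : measurableType d') (G : set (set U)) (g : (set U)^nat)
    (P : probability T R) (Q : set T) (X Y : T -> U) (c : R) :
  measurable = <<s G >> -> setI_closed G -> (forall k, G (g k)) ->
  \bigcup_k (g k) = setT ->
  measurable Q -> measurable_fun setT X -> measurable_fun setT Y -> 0 <= c ->
  (forall B, G B -> P (Q `&` X @^-1` B) = (c%:E * P (Y @^-1` B))%E) ->
  forall A, measurable A -> P (Q `&` X @^-1` A) = (c%:E * P (Y @^-1` A))%E.
Proof.
move=> mG GI Gg gT mQ mX mY c0 PG A mA.
pose c' : {nonneg R} := NngNum c0.
rewrite setIC.
apply: (@measure_unique _ _ _ G g mG GI Gg gT
   (pushforward (mrestr P mQ) X) (mscale c' (pushforward P Y))) => //.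
  move=> B GB; rewrite -[LHS]/(P (X @^-1` B `&` Q)).
  by rewrite -[RHS]/(c%:E * P (Y @^-1` B))%E setIC PG.
move=> k; apply: (@le_lt_trans _ _ 1%E); last exact: ltry.
rewrite /pushforward /mrestr; apply: probability_le1.
apply: measurableI => //; apply: measurable_preimage => //.
by rewrite mG; apply: sub_sigma_algebra; exact: Gg.
Qed.

(** Measurable rectangles, the pi-system generating the product sigma-algebra carried by [rvec]. *)
Definition boxes (R : realType) (I : Type) : set (set (I -> R)) :=
  [set A | exists2 B : I -> set R, (forall i, measurable (B i)) &
           A = [set x | forall i, B i (x i)]].

Notation rvec R I := (g_sigma_algebraType (@boxes R I)).

Section Rvec.
Variables (R : realType) (I : Type).

Lemma boxes_setI : setI_closed (@boxes R I).
Proof.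
move=> _ _ [B mB ->] [C mC ->]; exists (fun i => B i `&` C i).
  by move=> i; exact: measurableI.
apply/seteqP; split=> x /= => [[Bx Cx] i|BC]; first by split.
by split=> i; have [] := BC i.
Qed.

Lemma boxes_setT : @boxes R I setT.
Proof. by exists (fun=> setT) => //; apply/seteqP; split. Qed.

Lemma measurable_box (B : I -> set R) : (forall i, measurable (B i)) ->
  measurable ([set x | forall i, B i (x i)] : set (rvec R I)).
Proof. by move=> mB; apply: sub_sigma_algebra; exists B. Qed.

Lemma measurable_coord i : measurable_fun setT (fun x : rvec R I => x i).
Proof.
move=> _ B mB; rewrite setTI.
have -> : (fun x : rvec R I => x i) @^-1` B =
    [set x | forall j, (if `[< j = i >] then B else setT) (x j)].
  apply/seteqP; split=> x /= Bx; last by have := Bx i; rewrite asboolT.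
  by move=> j; case: asboolP => // ->.
apply: (measurable_box (B := fun j => if `[< j = i >] then B else setT)) => j.
by case: asboolP.
Qed.

Lemma measurable_rvec d (T : measurableType d) (f : T -> rvec R I) :
  finite_set [set: I] ->
  (forall i, measurable_fun setT (fun t => f t i)) -> measurable_fun setT f.
Proof.
move=> finI mf; apply: (@measurability _ _ T (rvec R I) setT f (@boxes R I)) => //.
move=> _ [_ [B mB ->] <-]; rewrite setTI.
have -> : f @^-1` [set x | forall i, B i (x i)] =
    \bigcap_(i in setT) ((fun t => f t i) @^-1` B i).
  by apply/seteqP; split=> t /= Bt i => [_|]; exact: Bt.
by apply: fin_bigcap_measurable => // i _; exact: measurable_preimage.
Qed.

Lemma rvec_law d (T : measurableType d) (P : probability T R) (Q : set T)
    (X Y : T -> rvec R I) (c : R) :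
  measurable Q -> measurable_fun setT X -> measurable_fun setT Y -> 0 <= c ->
  (forall B, (forall i, measurable (B i)) ->
    P (Q `&` [set w | forall i, B i (X w i)]) =
    (c%:E * P [set w | forall i, B i (Y w i)])%E) ->
  forall A, measurable A -> P (Q `&` X @^-1` A) = (c%:E * P (Y @^-1` A))%E.
Proof.
move=> mQ mX mY c0 PB.
apply: (@scaled_law_unique _ _ R T (rvec R I) (@boxes R I) (fun=> setT)) => //.
- exact: boxes_setI.
- by move=> _; exact: boxes_setT.
- by rewrite bigcup_const.
- by move=> _ [B mB ->]; exact: PB.
Qed.

End Rvec.

(** * Tails, memorylessness and mean overshoot of the exponential law *)

Section Exponential.
Variable R : realType.

Lemma exponential_prob_tail (x : R) : 0 <= x ->
  exponential_prob 1 `[x, +oo[ = (expR (- x))%:E.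
Proof.
move=> x0; rewrite /exponential_prob.
rewrite (@ge0_continuous_FTC2y _ _ (fun y => - expR (- 1 * y)) _ 0).
- by rewrite sub0e -EFinN opprK mulN1r.
- by move=> y _; exact: exponential_pdf_ge0.
- apply: (@continuous_subspaceW R^o _ _ [set` `[0, +oo[%R]).
    by apply: subset_itvr; rewrite bnd_simp.
  exact: within_continuous_exponential_pdf.
- rewrite -oppr0; apply: cvgN.
  under eq_fun do rewrite mulN1r.
  exact: cvgr_expR.
- by move=> y _; exact: ex_derive.
- apply: cvgN; apply/cvg_at_right_filter.
  apply: continuous_comp; last exact: continuous_expR.
  by apply: continuousM => //; apply: (@continuousN _ R^o); exact: cst_continuous.
- move=> y; rewrite in_itv/= andbT => xy.
  by apply: derive1_exponential_pdf; rewrite in_itv/= andbT (le_lt_trans x0).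
Qed.

Lemma exponential_prob_tail_open (x : R) : 0 <= x ->
  exponential_prob 1 `]x, +oo[ = (expR (- x))%:E.
Proof.
move=> x0; rewrite -exponential_prob_tail// /exponential_prob.
rewrite integral_itv_obnd_cbnd//; apply/measurable_EFinP/measurable_funTS.
exact: measurable_exponential_pdf.
Qed.

Variables (d : measure_display) (T : measurableType d) (P : probability T R).

Definition exponential_var (X : T -> R) : Prop :=
  measurable_fun setT X /\
  forall B, measurable B -> P (X @^-1` B) = exponential_prob 1 B.

Lemma exponential_var_neg X : exponential_var X -> P (X @^-1` `]-oo, 0[) = 0%E.
Proof.
move=> [mX PX].
have -> : X @^-1` `]-oo, 0[ = ~` (X @^-1` `[0, +oo[).
  apply/seteqP; split=> w /=; rewrite !in_itv/= andbT ltNge; first by move/negP.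
  by move=> /negP.
rewrite probability_setC; last exact: measurable_preimage.
by rewrite PX// exponential_prob_tail// oppr0 expR0 subee.
Qed.

(** Memorylessness for arbitrary events: on [a <= X], the excess [X - a] follows the law of [X]
    scaled by [expR (- a)]. Open half-lines form a pi-system, so tails suffice. *)
Lemma exponential_var_shift X a B : exponential_var X -> 0 <= a ->
  measurable B ->
  P [set w | a <= X w /\ B (X w - a)] = ((expR (- a))%:E * P (X @^-1` B))%E.
Proof.
move=> eX a0 mB; have [mX PX] := eX.
have mXa : measurable_fun setT (fun w => X w - a) by exact: measurable_funB.
have mQ : measurable (X @^-1` `[a, +oo[) by exact: measurable_preimage.
have -> : [set w | a <= X w /\ B (X w - a)] =
    X @^-1` `[a, +oo[ `&` (fun w => X w - a) @^-1` B.
  by apply/seteqP; split=> w /=; rewrite in_itv/= andbT.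
apply: (scaled_law_unique (G := @RGenOInfty.G R)
  (g := fun k => `]- k%:R, +oo[%classic)) => //.
- exact: RGenOInfty.measurableE.
- move=> _ _ [x ->] [y ->]; exists (Num.max x y).
  by apply/seteqP; split=> z /=; rewrite !in_itv/= !andbT gt_max => /andP.
- by move=> k; exists (- k%:R).
- apply/seteqP; split=> // z _.
  exists (Num.truncn `|z|).+1 => //=; rewrite in_itv/= andbT ltrNl.
  by rewrite (le_lt_trans _ (truncnS_gt _))// -normrN ler_norm.
move=> _ [x ->]; have [x0|x0] := leP 0 x.
  have -> : X @^-1` `[a, +oo[ `&` (fun w => X w - a) @^-1` `]x, +oo[ =
      X @^-1` `](x + a), +oo[.
    apply/seteqP; split=> w /=; rewrite !in_itv/= !andbT ltrBrDr; first by case.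
    by move=> xX; split=> //; rewrite (le_trans _ (ltW xX))// lerDr.
  rewrite !PX// !exponential_prob_tail_open ?addr_ge0//.
  by rewrite -EFinM -expRD -opprD addrC.
(* For negative [x] the excess is automatically above [x] on [a <= X], and [X > x] has probability
   one. *)
have -> : X @^-1` `[a, +oo[ `&` (fun w => X w - a) @^-1` `]x, +oo[ =
    X @^-1` `[a, +oo[.
  apply/seteqP; split=> w /=; rewrite !in_itv/= !andbT ltrBrDr; first by case.
  by move=> aX; split=> //; rewrite (lt_le_trans _ aX)// gtrDr.
rewrite [LHS]PX// exponential_prob_tail//.
suff -> : P (X @^-1` `]x, +oo[) = 1%E by rewrite mule1.
apply/eqP; rewrite eq_le; apply/andP; split.
  by apply: probability_le1; exact: measurable_preimage.
have -> : 1%E = P (X @^-1` `[0, +oo[).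
  by rewrite PX// exponential_prob_tail// oppr0 expR0.
apply: le_measure; rewrite ?inE; try exact: measurable_preimage.
by move=> w /=; rewrite !in_itv/= !andbT; exact: lt_le_trans.
Qed.

Lemma measurable_overshoot (c : R) : measurable_fun setT (overshoot c).
Proof.
apply: measurable_maxr => //; apply: measurable_maxr.
  exact: measurable_funB.
exact: measurable_funN.
Qed.

(** The mean is the integral of the tail, and the overshoot exceeds [r >= 0] only if [X > c + r] or
    [X < 0]. The latter is null and the former has probability [expR (- c) * expR (- r)]. *)
Lemma overshoot_mean X c : exponential_var X -> 0 <= c ->
  (\int[P]_w (overshoot c (X w))%:E <= (expR (- c))%:E)%E.
Proof.
move=> eX c0; have [mX PX] := eX.
have mO : measurable_fun setT (overshoot c \o X).
  by apply: measurableT_comp => //; exact: measurable_overshoot.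
pose O : {RV P >-> R} := HB.pack (overshoot c \o X)
  (isMeasurableFun.Build _ _ _ _ _ mO).
rewrite -[leLHS](expectation_def O) ge0_expectation_ccdf; last first.
  by move=> w; rewrite /O/= /overshoot le_max lexx.
(* The exponential density has mass one; writing the constant as an integral allows a comparison of
   integrands at each [r]. *)
have -> : (expR (- c))%:E =
    (\int[lebesgue_measure]_(r in `[0%R, +oo[)
      ((expR (- c))%:E * (exponential_pdf 1 r)%:E))%E.
  rewrite ge0_integralZl//.
  - rewrite -[X in _ = (_ * X)%E]/(exponential_prob 1 `[0, +oo[).
    by rewrite exponential_prob_tail// oppr0 expR0 mule1.
  - apply/measurable_EFinP/measurable_funTS; exact: measurable_exponential_pdf.
  - by move=> r _; rewrite lee_fin exponential_pdf_ge0.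
apply: ge0_le_integral => //.
- apply: measurable_funTS; exact: ccdf_measurable.
- apply: measurable_funeM; apply/measurable_EFinP/measurable_funTS.
  exact: measurable_exponential_pdf.
move=> r /=; rewrite in_itv/= andbT => r0.
rewrite /ccdf /distribution /pushforward.
apply: (@le_trans _ _ (P (X @^-1` `](c + r), +oo[ `|` X @^-1` `]-oo, 0[))).
  apply: le_measure; rewrite ?inE.
  - exact: measurable_preimage.
  - by apply: measurableU; exact: measurable_preimage.
  - move=> w /=; rewrite !in_itv/= !andbT /overshoot !lt_max.
    case/or3P; first by rewrite ltNge r0.
      by rewrite ltrBrDl; left.
    by rewrite ltrNr => h; right; rewrite (lt_le_trans h)// oppr_le0.
set A := X @^-1` _; set N := X @^-1` _.
apply: (@le_trans _ _ (P A + P N)%E).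
  by apply: measureU2; exact: measurable_preimage.
rewrite exponential_var_neg// adde0 /A PX// exponential_prob_tail_open ?addr_ge0//.
by rewrite opprD expRD EFinM exponential_pdfE// mul1r mulN1r.
Qed.

End Exponential.

(** * Discrete measurability and independent blocks *)

Section DiscreteMeasurable.
Context dT (T : measurableType dT).

(** Measurability for the discrete sigma-algebra on the codomain. *)
Definition discretely_measurable (C : Type) (h : T -> C) : Prop :=
  forall A : set C, measurable (h @^-1` A).

Lemma discretely_measurable_countable (C : countType) (h : T -> C) :
  (forall c, measurable (h @^-1` [set c])) -> discretely_measurable h.
Proof.
move=> mh A.
have -> : h @^-1` A = \bigcup_(c in [set: C])
    (if `[< A c >] then h @^-1` [set c] else set0).
  apply/seteqP; split=> [w Aw|w [c _]]; first by exists (h w) => //; rewrite asboolT.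
  by case: asboolP => // Ac /= ->.
apply: countable_bigcupT_measurable => // c.
by case: asboolP.
Qed.

Lemma discretely_measurable_comp (C D : Type) (h : T -> C) (g : C -> D) :
  discretely_measurable h -> discretely_measurable (g \o h).
Proof. by move=> mh A; rewrite comp_preimage; exact: mh. Qed.

Lemma discretely_measurable_pair (C D : countType) (h : T -> C) (g : T -> D) :
  discretely_measurable h -> discretely_measurable g ->
  discretely_measurable (fun w => (h w, g w)).
Proof.
move=> mh mg; apply: discretely_measurable_countable => -[c e].
have -> : (fun w => (h w, g w)) @^-1` [set (c, e)] =
    h @^-1` [set c] `&` g @^-1` [set e].
  by apply/seteqP; split=> w /= [-> ->].
exact: measurableI.
Qed.

Lemma discretely_measurable_ffun (I : finType) (C : countType) (h : I -> T -> C) :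
  (forall i, discretely_measurable (h i)) ->
  discretely_measurable (fun w => [ffun i => h i w]).
Proof.
move=> mh; apply: discretely_measurable_countable => f.
have -> : (fun w => [ffun i => h i w]) @^-1` [set f] =
    \bigcap_(i in setT) (h i @^-1` [set f i]).
  apply/seteqP; split=> w /= => [<- i _|hf]; first by rewrite /= ffunE.
  by apply/ffunP => i; rewrite ffunE; exact: hf.
by apply: fin_bigcap_measurable => // i _; exact: mh.
Qed.

Lemma measurable_fun_discrete d' (U : measurableType d') (C : countType)
    (h : T -> C) (f : C -> T -> U) :
  discretely_measurable h -> (forall c, measurable_fun setT (f c)) ->
  measurable_fun setT (fun w => f (h w) w).
Proof.
move=> mh mf _ B mB; rewrite setTI.
have -> : (fun w => f (h w) w) @^-1` B =
    \bigcup_(c in [set: C]) (h @^-1` [set c] `&` f c @^-1` B).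
  apply/seteqP; split=> [w Bw|w [c _ [/= <-]]//]; by exists (h w).
apply: countable_bigcupT_measurable => // c.
by apply: measurableI; [exact: mh|exact: measurable_preimage].
Qed.

Variable R : realType.

Lemma measurable_fun_dot n (v : action n) (x : T -> 'I_n -> R) :
  (forall i, measurable_fun setT (fun w => x w i)) ->
  measurable_fun setT (fun w => dot v (x w)).
Proof.
move=> mx; apply: measurable_sum => i.
by apply: measurable_funM => //; exact: measurable_cst.
Qed.

(** The minimizer, ties included, is a function [g] of the finite table [cmp] of pairwise
    comparisons, and each comparison is a measurable event. *)
Lemma discretely_measurable_argmin n (S : {set action n}) (x : T -> 'I_n -> R) :
  (forall i, measurable_fun setT (fun w => x w i)) ->
  discretely_measurable (fun w => argmin_dot S (x w)).
Proof.
move=> mx.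
pose cmp w := [ffun uv : action n * action n => dot uv.1 (x w) <= dot uv.2 (x w)].
pose v0 : action n := odflt [ffun=> false] [pick v in S].
pose g (c : {ffun action n * action n -> bool}) : action n :=
  odflt v0 (pick [pred v | v \in S & [forall (u | u \in S), c (v, u)]]).
have -> : (fun w => argmin_dot S (x w)) = g \o cmp.
  apply/funext => w; rewrite /g /=; congr (odflt _ _); apply: eq_pick => v /=.
  by congr (_ && _); apply: eq_forallb => u; rewrite ffunE.
apply: discretely_measurable_comp; apply: discretely_measurable_ffun => -[u v] B.
apply: measurable_preimage => //.
by apply: measurable_fun_ler; exact: measurable_fun_dot.
Qed.

Lemma discretely_measurable_leader n (S : {set action n}) (eta : R)
    (L z : T -> 'I_n -> R) :
  (forall i, measurable_fun setT (fun w => L w i)) ->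
  (forall i, measurable_fun setT (fun w => z w i)) ->
  discretely_measurable (fun w => perturbed_leader S eta (L w) (z w)).
Proof.
move=> mL mz; apply: discretely_measurable_argmin => i.
apply: measurable_funB => //; exact: measurable_funM.
Qed.

Variable P : probability T R.

Definition prob (A : set T) : R := fine (P A).

Lemma prob_ge0 A : 0 <= prob A.
Proof. exact: fine_ge0. Qed.

Lemma probE A : measurable A -> P A = (prob A)%:E.
Proof. by move=> mA; rewrite /prob fineK// fin_num_measure. Qed.

Lemma integral_finite_range (C : countType) (s : seq C) (h : T -> C) (f : C -> R) :
  uniq s -> (forall w, h w \in s) -> discretely_measurable h ->
  P.-integrable setT (fun w => (f (h w))%:E) /\
  (\int[P]_w (f (h w))%:E = (\sum_(c <- s) f c * prob (h @^-1` [set c]))%:E)%E.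
Proof.
move=> us hs mh.
pose t c w : \bar R := ((f c)%:E * (\1_(h @^-1` [set c]) w)%:E)%E.
have tE : (fun w => (f (h w))%:E) = (fun w => \sum_(c <- s) t c w)%E.
  apply/funext => w; rewrite (bigD1_seq (h w))//= /t big1 ?adde0.
    by rewrite indicE mem_set// mule1.
  move=> c /eqP ch; rewrite indicE memNset ?mule0// => /= hc.
  by apply: ch; rewrite hc.
have int1 c : P.-integrable setT (fun w => (\1_(h @^-1` [set c]) w : R)%:E).
  by apply: integrable_indic; rewrite // fin_num_measure// ltry.
have intt c : P.-integrable setT (t c) by exact: integrableZl.
rewrite tE; split; first exact: integrable_sum.
rewrite integral_sum// -sumEFin; apply: eq_bigr => c _.
rewrite /t integralZl// integral_indic// setIT EFinM; congr (_ * _)%E.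
exact: probE.
Qed.

End DiscreteMeasurable.

(** * Shifts and independent blocks of iid exponential families *)

Section IidExponential.
Context dT (T : measurableType dT) (R : realType) (P : probability T R).

(** Factorization over all of the finite index type at once; full sets in some coordinates recover
    the subfamilies. *)
Definition iid_exponential (I : finType) (X : I -> T -> R) : Prop :=
  (forall i, exponential_var P (X i)) /\
  forall B : I -> set R, (forall i, measurable (B i)) ->
    P [set w | forall i, B i (X i w)] = (\prod_i prob P (X i @^-1` B i))%:E.

Lemma measurable_iid (I : finType) (X : I -> T -> R) : iid_exponential X ->
  measurable_fun setT ((fun w i => X i w) : T -> rvec R I).
Proof. by move=> [eX _]; apply: measurable_rvec => // i; have [] := eX i. Qed.

Lemma prob_exponential (X Y : T -> R) B : exponential_var P X ->
  exponential_var P Y -> measurable B -> prob P (X @^-1` B) = prob P (Y @^-1` B).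
Proof. by move=> [_ PX] [_ PY] mB; rewrite /prob PX// PY. Qed.

(** On the event [Q] that every [X i] is at least [a i], the shifted vector has the law of [X]
    scaled by [expR (- \sum_i a i)], by memorylessness in each coordinate. Dropping [Q] gives the
    inequality. *)
Lemma iid_exponential_shift (I : finType) (X : I -> T -> R) (a : I -> R) A :
  iid_exponential X -> (forall i, 0 <= a i) -> measurable (A : set (rvec R I)) ->
  expR (- \sum_i a i) * prob P [set w | A (fun i => X i w)] <=
  prob P [set w | A (fun i => X i w - a i)].
Proof.
move=> iX a0 mA; have [eX PX] := iX.
have mX i : measurable_fun setT (X i) by have [] := eX i.
pose Y w : rvec R I := fun i => X i w - a i.
have mY : measurable_fun setT Y.
  by apply: measurable_rvec => // i; exact: measurable_funB.
have mXv := measurable_iid iX.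
pose Q := \bigcap_(i in [set: I]) (X i @^-1` `[a i, +oo[).
have mQ : measurable Q.
  by apply: fin_bigcap_measurable => // i _; exact: measurable_preimage.
have mYA := measurable_preimage mY mA.
have mXA := measurable_preimage mXv mA.
have QY : P (Q `&` Y @^-1` A) =
    ((expR (- \sum_i a i))%:E * P ((fun w i => X i w) @^-1` A))%E.
  apply: rvec_law => // B mB; rewrite PX// -EFinM.
  pose B' i := `[a i, +oo[ `&` (fun z => z - a i) @^-1` B i.
  have mB' i : measurable (B' i).
    apply: measurableI => //; apply: measurable_preimage => //.
    exact: measurable_funB.
  have -> : Q `&` [set w | forall i, B i (Y w i)] = [set w | forall i, B' i (X i w)].
    apply/seteqP; split=> w /= => [[Qw Bw] i|Bw].
      by split; [exact: Qw|exact: Bw].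
    by split=> i => [_|]; have [] := Bw i.
  rewrite PX//; congr (_%:E).
  rewrite -sumrN expR_sum -big_split/=; apply: eq_bigr => i _.
  apply: EFin_inj; rewrite EFinM -!probE//; try exact: measurable_preimage.
  rewrite -exponential_var_shift//; congr (P _).
  by apply/seteqP; split=> w; rewrite /B' /= in_itv/= andbT.
rewrite -lee_fin EFinM -!probE// -[X in (X <= _)%E]QY.
by apply: le_measure; rewrite ?inE//; exact: measurableI.
Qed.

Section Blocks.
Variables (B I : finType) (X : B -> I -> T -> R) (b0 : B).
Hypothesis iX : iid_exponential (fun bi : B * I => X bi.1 bi.2).

Lemma iid_block b : iid_exponential (X b).
Proof.
have [eX PX] := iX; split=> [i|C mC]; first exact: (eX (b, i)).
pose C' (bi : B * I) := if bi.1 == b then C bi.2 else setT.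
have mC' bi : measurable (C' bi) by rewrite /C'; case: ifP.
have := PX C' mC'.
have -> : [set w | forall bi, C' bi (X bi.1 bi.2 w)] = [set w | forall i, C i (X b i w)].
  apply/seteqP; split=> w /= Cw; first by move=> i; have := Cw (b, i); rewrite /C' eqxx.
  by move=> [b' i]; rewrite /C' /=; case: eqP => // ->.
move=> ->; congr (_%:E).
rewrite -(pair_bigA _ (fun b' i => prob P (X b' i @^-1` C' (b', i))))/=.
rewrite (bigD1 b)//= [X in _ * X]big1 ?mulr1; last first.
  move=> b' /negbTE b'b; apply: big1 => i _.
  by rewrite /C' b'b preimage_setT /prob probability_setT.
by apply: eq_bigr => i _; rewrite /C' eqxx.
Qed.

(** Independence is given on boxes and extended to general measurable sets one block at a time by
    [rvec_law]. All blocks have the same law, so every factor is evaluated at the reference block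
    [b0]. *)
Lemma iid_blocks_independent (F : B -> set (rvec R I)) :
  (forall b, measurable (F b)) ->
  P [set w | forall b, F b (fun i => X b i w)] =
  (\prod_b prob P [set w | F b (fun i => X b0 i w)])%:E.
Proof.
have mX b := measurable_iid (iid_block b).
(* Blocks outside [s] carry boxes. The empty list is the hypothesis [iX], and each induction step
   frees one more block, the others forming the event [Q]. *)
suff H (s : seq B) (G : B -> set (rvec R I)) : (forall b, measurable (G b)) ->
    (forall b, b \notin s -> @boxes R I (G b)) ->
    P [set w | forall b, G b (fun i => X b i w)] =
    (\prod_b prob P [set w | G b (fun i => X b0 i w)])%:E.
  by move=> mF; apply: (H (enum B)) => // b; rewrite mem_enum.
elim: s G => [|b s IH] G mG boxG.
  have /choice[C CE] : forall b, exists C : I -> set R,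
      (forall i, measurable (C i)) /\ G b = [set x | forall i, C i (x i)].
    by move=> b; have [C mC ->] := boxG b isT; exists C.
  have mC b i : measurable (C b i) by have [] := CE b.
  have [_ PX] := iX.
  have := PX (fun bi => C bi.1 bi.2) (fun bi => mC bi.1 bi.2).
  have -> : [set w | forall bi, C bi.1 bi.2 (X bi.1 bi.2 w)] =
      [set w | forall b, G b (fun i => X b i w)].
    apply/seteqP; split=> w /= Cw.
      by move=> b; rewrite (CE b).2 => i; exact: (Cw (b, i)).
    by move=> [b i]; have := Cw b; rewrite (CE b).2; apply.
  move=> ->; congr (_%:E).
  rewrite -(pair_bigA _ (fun b i => prob P (X b i @^-1` C b i)))/=.
  apply: eq_bigr => b _; apply: EFin_inj.
  have [eX0 PX0] := iid_block b0.
  rewrite (CE b).2 -probE; last first.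
    exact: (measurable_preimage (mX b0) (measurable_box (mC b))).
  rewrite PX0//; congr (_%:E); apply: eq_bigr => i _.
  by apply: prob_exponential => //; have [eX _] := iid_block b.
pose Q := \bigcap_(b' in [set b' | b' != b])
  ((fun w => (fun i => X b' i w) : rvec R I) @^-1` G b').
have mQ : measurable Q.
  apply: fin_bigcap_measurable => [|b' _]; first exact: finite_finset.
  exact: measurable_preimage.
pose c := \prod_(b' | b' != b) prob P [set w | G b' (fun i => X b0 i w)].
have c0 : 0 <= c by apply: prodr_ge0 => b' _; exact: prob_ge0.
rewrite (bigD1 b)//= mulrC EFinM -probE; last exact: (measurable_preimage (mX b0)).
have <- : Q `&` (fun w => (fun i => X b i w) : rvec R I) @^-1` G b =
    [set w | forall b, G b (fun i => X b i w)].
  apply/seteqP; split=> w /= => [[Qw Gw] b'|Gw]; last by split=> // b' _; exact: Gw.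
  by have [->//|b'b] := eqVneq b' b; exact: Qw.
apply: (rvec_law (X := fun w i => X b i w) (Y := fun w i => X b0 i w)) => // C mC.
pose G' b' := if b' == b then [set x : rvec R I | forall i, C i (x i)] else G b'.
have mG' b' : measurable (G' b').
  by rewrite /G'; case: ifP => // _; exact: measurable_box.
have boxG' b' : b' \notin s -> @boxes R I (G' b').
  rewrite /G'; case: ifPn => [_ _|b'b b's]; first by exists C.
  by apply: boxG; rewrite inE negb_or b'b.
have := IH G' mG' boxG'.
have -> : [set w | forall b', G' b' (fun i => X b' i w)] =
    Q `&` [set w | forall i, C i (X b i w)].
  apply/seteqP; split=> w /= => [Gw|[Qw Cw] b'].
    split=> [b' /= b'b|]; first by have := Gw b'; rewrite /G' (negbTE b'b).
    by have := Gw b; rewrite /G' eqxx.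
  by rewrite /G'; case: ifPn => [/eqP ->//|b'b]; exact: Qw.
move=> ->; rewrite (bigD1 b)//= mulrC EFinM; congr (_ * _)%E.
  congr (_%:E); apply: eq_bigr => b' /negbTE b'b.
  by rewrite /G' b'b.
rewrite /G' eqxx -probE//.
exact: (measurable_preimage (mX b0) (measurable_box mC)).
Qed.

End Blocks.
End IidExponential.

(** * The regret for a deterministic environment *)

Section LeaderProbability.
Context dO (Omega : measurableType dO) (R : realType) (P : probability Omega R).
Variables (d : nat) (S : {set action d}) (eta : R) (X : 'I_d -> Omega -> R).
Hypothesis S_neq0 : S != finset.set0.
Hypothesis eta_gt0 : 0 < eta.
Hypothesis iX : iid_exponential P X.

Definition leader_prob (L : 'I_d -> R) (v : action d) : R :=
  prob P [set w | perturbed_leader S eta L (fun i => X i w) = v].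

Let leader L w := perturbed_leader S eta L (fun i => X i w).

Let mX i : measurable_fun setT (X i).
Proof. by have [eX _] := iX; have [] := eX i. Qed.

Let mleader L : discretely_measurable (leader L).
Proof. exact: discretely_measurable_leader. Qed.

Lemma measurable_leader_set L v : measurable
  ([set z | perturbed_leader S eta L z = v] : set (rvec R 'I_d)).
Proof.
apply: (@discretely_measurable_leader _ (rvec R 'I_d) R d S eta (fun _ => L) id
  _ _ [set v]) => // i.
exact: measurable_coord.
Qed.

Lemma leader_prob_ge0 L v : 0 <= leader_prob L v.
Proof. exact: prob_ge0. Qed.

Lemma integral_leader L (f : action d -> R) :
  P.-integrable setT (fun w => (f (leader L w))%:E) /\
  (\int[P]_w (f (leader L w))%:E = (\sum_v leader_prob L v * f v)%:E)%E.
Proof.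
have in_enum w : leader L w \in enum {: action d} by rewrite mem_enum.
have [intf ->] := integral_finite_range P f (enum_uniq _) in_enum (mleader L).
split=> //; rewrite big_enum; congr (_%:E); apply: eq_bigr => v _.
by rewrite mulrC.
Qed.

Lemma leader_prob_sum1 L : \sum_v leader_prob L v = 1.
Proof.
have [_ E1] := integral_leader L (fun=> 1).
apply: EFin_inj; transitivity (\int[P]_w (1 : R)%:E)%E.
  by rewrite E1; congr (_%:E); apply: eq_bigr => v _; rewrite mulr1.
by rewrite integral_cst// mul1e [LHS]probability_setT.
Qed.

Lemma leader_prob_supp L v : leader_prob L v != 0 -> v \in S.
Proof.
apply: contraR => vS; rewrite /leader_prob [X in prob P X](_ : _ = set0).
  by rewrite /prob measure0.
apply/seteqP; split=> // w /= vE.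
by move: vS; rewrite -vE [_ \in _]argmin_dot_in.
Qed.

(* A shift of the perturbation by [eta v x] turns the old leader [v] into the
   new one, and costs a factor [exp (- eta v.x)] by memorylessness. *)
Lemma leader_prob_stable L x v : (forall i, 0 <= x i) ->
  leader_prob L v * (1 - eta * dot v x) <= leader_prob (fun i => L i + x i) v.
Proof.
move=> x0; pose a i := eta * ((v i)%:R * x i).
have a0 i : 0 <= a i by rewrite !mulr_ge0// ltW.
have := iid_exponential_shift iX a0 (measurable_leader_set L v).
have -> : \sum_i a i = eta * dot v x by rewrite mulr_sumr.
move=> shift; apply: le_trans; last first.
  apply: (le_trans shift); rewrite -lee_fin -!probE; last 2 first.
  - exact: (mleader _ [set v]).
  - have mXa i : measurable_fun setT (fun w => X i w - a i) by exact: measurable_funB.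
    exact: (@discretely_measurable_leader _ Omega R d S eta (fun _ => L)
      (fun w i => X i w - a i) _ _ [set v]).
  apply: le_measure; rewrite ?inE.
  - have mXa i : measurable_fun setT (fun w => X i w - a i) by exact: measurable_funB.
    exact: (@discretely_measurable_leader _ Omega R d S eta (fun _ => L)
      (fun w i => X i w - a i) _ _ [set v]).
  - exact: (mleader _ [set v]).
  - by move=> w /=; apply: perturbed_leader_stable => //; exact: ltW.
rewrite mulrC ler_wpM2r ?leader_prob_ge0//.
exact: expR_ge1Dx.
Qed.

Section Foresight.
Variables (M : nat) (loss : seq (action d) -> 'I_d -> R).

Lemma integral_foresight_loss (a : seq (outcome d M)) :
  P.-integrable setT (fun w => (foresight_loss S eta loss (fun i => X i w) a)%:E) /\
  (\int[P]_w (foresight_loss S eta loss (fun i => X i w) a)%:E =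
    (mean_foresight_loss loss leader_prob a)%:E)%E.
Proof.
elim: a => [|o a [intIH IH]]; first by split; [exact: integrable0|rewrite integral0].
have [intl El] := integral_leader (history_estimate loss (o :: a))
  (fun v => dot v (loss_estimate (history_loss loss a) o.1 o.2)).
split=> /=.
  by under eq_fun do rewrite EFinD; exact: integrableD.
under eq_integral do rewrite EFinD.
by rewrite integralD// IH [X in (_ + X)%E]El.
Qed.

(** The pointwise bound [foresight_loss_le] is averaged over the perturbation, each coordinate
    contributing a mean overshoot of at most [expR (- c)]. *)
Lemma mean_foresight_loss_le m c u (a : seq (outcome d M)) :
  (forall v, v \in S -> (l1norm v <= m)%N) -> 0 <= c -> u \in S ->
  mean_foresight_loss loss leader_prob a <=
  dot u (history_estimate loss a) + (m%:R * c + d%:R * expR (- c)) / eta.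
Proof.
move=> Sm c0 uS; have [intF EF] := integral_foresight_loss a.
have [eX _] := iX.
pose g w := \sum_i overshoot c (X i w).
have mO i : measurable_fun setT (fun w => overshoot c (X i w)).
  by apply: measurableT_comp => //; exact: measurable_overshoot.
have O0 i w : (0 <= (overshoot c (X i w))%:E)%E.
  by rewrite lee_fin /overshoot le_max lexx.
have mg : measurable_fun setT g by exact: measurable_sum.
have g0 w : (0 <= (g w)%:E)%E by rewrite -sumEFin; exact: sume_ge0.
have Eg : (\int[P]_w (g w)%:E <= (d%:R * expR (- c))%:E)%E.
  under eq_integral do rewrite /g -sumEFin.
  rewrite ge0_integral_sum//; last by move=> i; exact/measurable_EFinP.
  apply: (@le_trans _ _ (\sum_(i < d) (expR (- c))%:E)%E).
    by apply: lee_sum => i _; exact: overshoot_mean.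
  by rewrite sumEFin sumr_const card_ord mulr_natl.
have intg : P.-integrable setT (EFin \o g).
  apply/integrableP; split; first exact/measurable_EFinP.
  have gR w : 0 <= g w by rewrite -lee_fin.
  under eq_integral => w _ do rewrite /= (ger0_norm (gR w)).
  by apply: le_lt_trans Eg _; exact: ltry.
pose k := dot u (history_estimate loss a) + m%:R * c / eta.
have intk : P.-integrable setT (fun w => (k%:E + eta^-1%:E * (g w)%:E)%E).
  apply: integrableD => //; last exact: integrableZl.
  exact: finite_measure_integrable_cst.
rewrite -lee_fin -EF.
apply: (@le_trans _ _ (\int[P]_w (k%:E + eta^-1%:E * (g w)%:E))%E).
  apply: le_integral => // w _.
  rewrite -EFinM -EFinD lee_fin /k.
  apply: (le_trans (foresight_loss_le loss _ a S_neq0 Sm eta_gt0 c0 uS)).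
  by rewrite -/(g w) mulrDl [eta^-1 * _]mulrC addrA.
rewrite integralD//; last 2 first.
- exact: finite_measure_integrable_cst.
- exact: integrableZl.
have -> : (\int[P]_w k%:E = k%:E)%E.
  by rewrite integral_cst//; rewrite [X in (_ * X)%E]probability_setT mule1.
rewrite integralZl//.
apply: (@le_trans _ _ (k%:E + eta^-1%:E * (d%:R * expR (- c))%:E)%E).
  by rewrite leeD2l// lee_wpmul2l// lee_fin invr_ge0 ltW.
by rewrite -EFinM -EFinD lee_fin /k mulrDl [eta^-1 * _]mulrC addrA.
Qed.

End Foresight.
End LeaderProbability.

Lemma big_option (R : Type) (idx : R) (op : Monoid.com_law idx) (I : finType)
    (F : option I -> R) :
  \big[op/idx]_k F k = op (F None) (\big[op/idx]_i F (Some i)).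
Proof.
rewrite (bigD1 None)//=; congr (op _ _).
by rewrite (reindex_omap Some id) => [|[]//]; apply: eq_bigl => i; rewrite eqxx.
Qed.

Section Run.
Context dO (Omega : measurableType dO) (R : realType) (P : probability Omega R).
Variables (d M T : nat) (S : {set action d}) (eta : R).
Variables (Z : nat -> 'I_d -> Omega -> R) (Z' : nat -> nat -> 'I_d -> Omega -> R).
Variable loss : seq (action d) -> 'I_d -> R.
Hypothesis S_neq0 : S != finset.set0.
Hypothesis eta_gt0 : 0 < eta.
Hypothesis T_gt0 : (0 < T)%N.

(** [None] indexes the perturbation used to play and [Some k] those of the resamples, so that the
    [M + 1] draws of a round are blocks of one iid family. *)
Definition perturbation (b : 'I_T * option 'I_M) : 'I_d -> Omega -> R :=
  if b.2 is Some k then Z' b.1 k else Z b.1.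

Hypothesis iZ : iid_exponential P
  (fun bi : ('I_T * option 'I_M) * 'I_d => perturbation bi.1 bi.2).

Let b0 : 'I_T * option 'I_M := (Ordinal T_gt0, None).

Let p := leader_prob P S eta (perturbation b0).

Definition run n w :=
  history M S eta loss (fun t i => Z t i w) (fun t k i => Z' t k i w) n.

(** Once the past is prescribed the estimate is a constant, so prescribing a history constrains each
    block of perturbations separately. Blocks of rounds from [n] on stay unconstrained. *)
Lemma run_event n a : (n <= T)%N -> size a = n ->
  exists F : 'I_T * option 'I_M -> set (rvec R 'I_d),
    [/\ forall b, measurable (F b),
        forall b : 'I_T * option 'I_M, (n <= b.1)%N -> F b = setT,
        [set w | run n w = a] = [set w | forall b, F b (fun i => perturbation b i w)] &
        history_weight loss p a =
        \prod_b prob P [set w | F b (fun i => perturbation b0 i w)]].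
Proof.
elim: n a => [|n IH] [|o a]//= nT.
  move=> _; exists (fun=> setT); split=> //.
    by apply/seteqP; split.
  by rewrite big1// => b _; rewrite /prob [X in P X](_ : _ = setT) ?probability_setT.
case=> an; have [F [mF FT Fa Fw]] := IH a (ltnW nT) an.
pose t0 := Ordinal nT.
pose L := history_estimate loss a.
(* The blocks of the new round must produce the prescribed leaders for the fixed estimate [L]; all
   other blocks keep their constraint. *)
pose G (b : 'I_T * option 'I_M) : set (rvec R 'I_d) :=
  if b.1 == t0 then
    [set z | perturbed_leader S eta L z = if b.2 is Some k then o.2 k else o.1]
  else F b.
exists G; split.
- move=> b; rewrite /G; case: ifP => // _.
  by case: (b.2) => [k|]; exact: measurable_leader_set.
- move=> b nb; rewrite /G ifN; first by apply: FT; exact: ltnW.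
  by apply/eqP => bt; move: nb; rewrite bt /= ltnn.
- have -> : [set w | run n.+1 w = o :: a] =
      [set w | run n w = a] `&`
      [set w | forall k, perturbed_leader S eta L (fun i => perturbation (t0, k) i w)
                         = if k is Some k' then o.2 k' else o.1].
    apply/seteqP; split=> w /=; rewrite /run /=.
      case=> oE aE; rewrite aE in oE; split=> // -[k|]; rewrite -oE/=.
        by rewrite ffunE.
      by [].
    case=> aE oE; rewrite aE; congr (_ :: _); rewrite /round_outcome.
    rewrite (surjective_pairing o); congr (_, _); first exact: (oE None).
    by apply/ffunP => k; rewrite ffunE; exact: (oE (Some k)).
  rewrite Fa; apply/seteqP; split=> w /=.
    move=> [Fw' oE] [t k]; rewrite /G /=; case: ifPn => [/eqP ->|_].
      exact: oE.
    exact: Fw'.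
  move=> Gw; split=> [[t k]|k].
    have := Gw (t, k); rewrite /G /=; case: ifPn => [/eqP -> _|//].
    by rewrite FT.
  by have := Gw (t0, k); rewrite /G eqxx.
rewrite /= Fw -/L.
have pairE (H : 'I_T * option 'I_M -> R) :
    \prod_b H b = \prod_t \prod_k H (t, k).
  by rewrite pair_bigA; apply: eq_bigr => -[].
rewrite !pairE.
(* In the old product the blocks of round [t0] are unconstrained and contribute 1; in the new one
   they contribute the [M + 1] leader probabilities that make up [outcome_weight]. *)
rewrite (bigD1 t0)//= [RHS](bigD1 t0)//= [X in X * _ * _]big1 ?mul1r; last first.
  move=> k _; rewrite FT//= /prob [X in P X](_ : _ = setT) ?probability_setT//.
rewrite mulrC; congr (_ * _).
  by rewrite big_option /G /= eqxx; congr (_ * _).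
by apply: eq_bigr => t /negbTE tt0; apply: eq_bigr => k _; rewrite /G tt0.
Qed.

Lemma run_law n a : (n <= T)%N -> size a = n ->
  measurable [set w | run n w = a] /\
  prob P [set w | run n w = a] = history_weight loss p a.
Proof.
move=> nT an; have [F [mF _ -> ->]] := run_event nT an.
split; last first.
  by rewrite /prob (iid_blocks_independent b0 iZ mF).
have -> : [set w | forall b, F b (fun i => perturbation b i w)] =
   \bigcap_(b in setT) ((fun w => (fun i => perturbation b i w) : rvec R 'I_d) @^-1` F b).
  by apply/seteqP; split=> w /= Fw b => [_|]; exact: Fw.
apply: fin_bigcap_measurable => // b _; apply: measurable_preimage => //.
exact: (measurable_iid (iid_block iZ b)).
Qed.

Lemma size_run n w : size (run n w) = n.
Proof. by rewrite /run; elim: n => //= n ->. Qed.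

Lemma run_regret m c u : (0 < M)%N -> (forall v, v \in S -> (l1norm v <= m)%N) ->
  (forall h i, 0 <= loss h i <= 1) -> 0 <= c -> u \in S ->
  (\int[P]_w (history_regret loss u (run T w))%:E <=
   ((m%:R * c + d%:R * expR (- c)) / eta
    + T%:R * (2 * eta * m%:R * d%:R + d%:R / (expR 1 * M%:R)))%:E)%E.
Proof.
move=> M0 Sm l01 c0 uS.
have in_histories w : run T w \in histories d M T.
  by rewrite mem_histories size_run.
have mrun : discretely_measurable (run T).
  apply: discretely_measurable_countable => a.
  have [an|an] := eqVneq (size a) T; first by have [] := run_law (leqnn T) an.
  rewrite [X in measurable X](_ : _ = set0)//; apply/seteqP; split=> // w /= aE.
  by move: an; rewrite -aE size_run eqxx.
have [_ ->] := integral_finite_range P (history_regret loss u)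
  (uniq_histories _ _ _) in_histories mrun.
rewrite lee_fin; apply: le_trans (history_mean_regret (p := p) _ _ _ M0 _ _ l01 _ T).
- rewrite !big_seq le_eqVlt; apply/orP; left; apply/eqP; apply: eq_bigr => a.
  rewrite mem_histories => /eqP an; rewrite mulrC; congr (_ * _).
  by have [] := run_law (leqnn T) an.
- exact: leader_prob_ge0.
- by move=> L; apply: leader_prob_sum1; exact: (iid_block iZ b0).
- exact: ltW.
- by move=> L v /(leader_prob_supp S_neq0); exact: Sm.
- by move=> L x v; exact: (leader_prob_stable S_neq0 eta_gt0 (iid_block iZ b0)).
- move=> a.
  exact: (mean_foresight_loss_le S_neq0 eta_gt0 (iid_block iZ b0)).
Qed.

End Run.

(** * Averaging over the environment *)

Section IndependentIntegral.
Context dO d1 d2 (Omega : measurableType dO) (U1 : measurableType d1)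
  (U2 : measurableType d2) (R : realType) (P : probability Omega R).
Variables (X : Omega -> U1) (Y : Omega -> U2).
Hypothesis mX : measurable_fun setT X.
Hypothesis mY : measurable_fun setT Y.
Hypothesis indXY : forall A B, measurable A -> measurable B ->
  P (X @^-1` A `&` Y @^-1` B) = (P (X @^-1` A) * P (Y @^-1` B))%E.

(** By independence the joint law is the product of the marginal laws. Boundedness of [f] gives
    integrability, so Fubini applies and the inner integral is at most [C] for each fixed [x]. *)
Lemma integral_independent_le (f : U1 * U2 -> R) (k C : R) :
  measurable_fun setT f -> (forall z, `|f z| <= k) ->
  (forall x, (\int[P]_w (f (x, Y w))%:E <= C%:E)%E) ->
  (\int[P]_w (f (X w, Y w))%:E <= C%:E)%E.
Proof.
move=> mf fk fC.
pose X' : {RV P >-> U1} := HB.pack X (isMeasurableFun.Build _ _ _ _ _ mX).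
pose Y' : {RV P >-> U2} := HB.pack Y (isMeasurableFun.Build _ _ _ _ _ mY).
have mXY : measurable_fun setT (fun w => (X w, Y w)) by exact: measurable_fun_pair.
pose XY : {RV P >-> (U1 * U2)%type} :=
  HB.pack (fun w => (X w, Y w)) (isMeasurableFun.Build _ _ _ _ _ mXY).
have mEf : measurable_fun setT (EFin \o f) by exact/measurable_EFinP.
have bounded_integrable d' (V : measurableType d') (mu : {measure set V -> \bar R})
    (g : V -> \bar R) : (mu setT < +oo)%E -> measurable_fun setT g ->
    (forall z, `|g z| <= k%:E)%E -> mu.-integrable setT g.
  move=> muT mg gk; apply: (@le_integrable _ _ _ mu setT _ _ (cst k%:E)) => //.
    by move=> z _; apply: (le_trans (gk z)); rewrite /= lee_fin ler_norm.
  apply/integrableP; split => //=.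
  by rewrite integral_cst//= lte_mul_pinfty.
have E1 : (\int[P]_w (f (X w, Y w))%:E = \int[distribution P XY]_z (f z)%:E)%E.
  rewrite (integral_pushforward mXY mEf)//.
  apply: bounded_integrable => //; first by rewrite [X in (X < _)%E]probability_setT ltry.
    exact: measurableT_comp.
  by move=> z; rewrite lee_fin.
have E2 : (\int[distribution P XY]_z (f z)%:E =
    \int[distribution P X' \x distribution P Y']_z (f z)%:E)%E.
  apply: eq_measure_integral => A mA _; apply/esym.
  by apply: product_measure_unique => // B1 B2 mB1 mB2; exact: indXY.
have mass1 : ((distribution P X' \x distribution P Y') setT = 1)%E.
  rewrite -setXTT product_measure1E//.
  by rewrite [X in (X * _)%E]probability_setT [X in (_ * X)%E]probability_setT mule1.
have intf : (distribution P X' \x distribution P Y')%E.-integrable setT (EFin \o f).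
  apply: bounded_integrable => //; first by rewrite [X in (X < _)%E]mass1 ltry.
rewrite E1 E2 -integral12_prod_meas1//.
apply: (@le_trans _ _ (\int[distribution P X']_x C%:E)%E).
  apply: le_integral => //; first exact: integrable_fubini_F.
    exact: finite_measure_integrable_cst.
  move=> x _; rewrite /fubini_F.
  have mfx : measurable_fun setT (fun y => (f (x, y))%:E).
    apply/measurable_EFinP; apply: (measurableT_comp mf).
    exact: measurable_pair1.
  rewrite (integral_pushforward mY mfx)//; first exact: fC.
  apply: bounded_integrable => //; first by rewrite [X in (X < _)%E]probability_setT ltry.
    exact: measurableT_comp.
  by move=> z; rewrite lee_fin.
by rewrite integral_cst// [X in (_ * X)%E]probability_setT mule1.
Qed.

End IndependentIntegral.

(** For a fixed list of outcomes the actions do not involve the loss map, so the loss of a round is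
    the environment evaluated at a fixed argument. *)
Lemma history_actionsE (R : realType) d M (loss : seq (action d) -> 'I_d -> R)
    (a : seq (outcome d M)) : (history_state loss a).1 = rev (map fst a).
Proof.
elim: a => //= o a; case: (history_state loss a) => h L /= ->.
by rewrite rev_cons.
Qed.

(** This allows the infinite families of perturbations to be replaced by a vector with finitely many
    coordinates. *)
Lemma history_ext (R : realType) d M (S : {set action d}) (eta : R)
    (loss : seq (action d) -> 'I_d -> R) (z1 z2 : nat -> 'I_d -> R)
    (z1' z2' : nat -> nat -> 'I_d -> R) n :
  (forall t i, (t < n)%N -> z1 t i = z2 t i) ->
  (forall t k i, (t < n)%N -> (k < M)%N -> z1' t k i = z2' t k i) ->
  history M S eta loss z1 z1' n = history M S eta loss z2 z2' n.
Proof.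
elim: n => //= n IH zE zE'.
rewrite IH; last 2 first.
- by move=> t i tn; apply: zE; exact: ltnW.
- by move=> t k i tn kM; apply: zE' => //; exact: ltnW.
congr (_ :: _); rewrite /round_outcome; congr (_, _).
  by congr perturbed_leader; apply/funext => i; exact: zE.
apply/ffunP => k; rewrite !ffunE; congr perturbed_leader.
by apply/funext => i; exact: zE'.
Qed.

(** A crude bound of [d] per round, which supplies the boundedness required by Fubini. *)
Lemma history_regret_bound (R : realType) d M (loss : seq (action d) -> 'I_d -> R)
    u (a : seq (outcome d M)) : (forall h i, 0 <= loss h i <= 1) ->
  `|history_regret loss u a| <= (size a * d)%:R.
Proof.
move=> l01; elim: a => [|o a IH] /=; first by rewrite normr0.
apply: (le_trans (ler_normD _ _)); rewrite mulSn addnC natrD lerD//.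
rewrite /dot -sumrB; apply: (le_trans (ler_norm_sum _ _ _)).
have -> : d%:R = \sum_(i < d) 1 :> R by rewrite sumr_const card_ord.
apply: ler_sum => i _; have /andP[l0 l1] := l01 (history_state loss a).1 i.
rewrite /history_loss ler_norml.
by case: (o.1 i); case: (u i); rewrite /= ?mulr1n ?mulr0n; apply/andP; split; lra.
Qed.

Section MeasurableRun.
Context dU (U : measurableType dU) (R : realType).
Variables (d M : nat) (S : {set action d}) (eta : R).
Variables (loss : U -> seq (action d) -> 'I_d -> R).
Variables (z : U -> nat -> 'I_d -> R) (z' : U -> nat -> nat -> 'I_d -> R).
Hypothesis mloss : forall h i, measurable_fun setT (fun x => loss x h i).
Hypothesis mz : forall t i, measurable_fun setT (fun x => z x t i).
Hypothesis mz' : forall t k i, measurable_fun setT (fun x => z' x t k i).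

Lemma measurable_history_loss (a : seq (outcome d M)) i :
  measurable_fun setT (fun x => history_loss (loss x) a i).
Proof.
under eq_fun do rewrite /history_loss history_actionsE.
exact: mloss.
Qed.

Lemma measurable_history_estimate (a : seq (outcome d M)) i :
  measurable_fun setT (fun x => history_estimate (loss x) a i).
Proof.
elim: a => [|o a IH]; first exact: measurable_cst.
under eq_fun do rewrite history_estimate_cons.
apply: measurable_funD => //; apply: measurable_funM => //.
exact: measurable_history_loss.
Qed.

(** To prescribe the history, prescribe its past [a] first: the new outcome may then be computed
    from the estimate of the fixed list [a], which is measurable in [x]. *)
Lemma discretely_measurable_history n :
  discretely_measurable (fun x => history M S eta (loss x) (z x) (z' x) n).
Proof.
elim: n => [|n IH] /=.
  apply: discretely_measurable_countable => a.
  have [->|a0] := eqVneq a [::].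
    by rewrite [X in measurable X](_ : _ = setT)//; apply/seteqP; split.
  rewrite [X in measurable X](_ : _ = set0)//; apply/seteqP; split=> // x /= aE.
  by move: a0; rewrite -aE eqxx.
apply: discretely_measurable_countable => -[|o a].
  by rewrite [X in measurable X](_ : _ = set0)//; apply/seteqP; split.
have -> : (fun x => round_outcome M S eta
      (history_estimate (loss x) (history M S eta (loss x) (z x) (z' x) n))
      (z x n) (z' x n) :: history M S eta (loss x) (z x) (z' x) n) @^-1` [set o :: a] =
    (fun x => round_outcome M S eta (history_estimate (loss x) a) (z x n) (z' x n))
      @^-1` [set o] `&`
    (fun x => history M S eta (loss x) (z x) (z' x) n) @^-1` [set a].
  by apply/seteqP; split=> x /= => [[<- <-]//|[oE aE]]; rewrite aE oE.
apply: measurableI; last exact: IH.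
have mL := measurable_history_estimate a.
apply: (@discretely_measurable_pair _ U).
  exact: discretely_measurable_leader.
apply: discretely_measurable_ffun => k.
exact: discretely_measurable_leader.
Qed.

Lemma measurable_history_regret u n : measurable_fun setT (fun x =>
  history_regret (loss x) u (history M S eta (loss x) (z x) (z' x) n)).
Proof.
apply: (measurable_fun_discrete (f := fun a x => history_regret (loss x) u a)).
  exact: discretely_measurable_history.
elim=> [|o a IH] /=; first exact: measurable_cst.
apply: measurable_funD => //; apply: measurable_funB.
all: apply: measurable_fun_dot => i; exact: measurable_history_loss.
Qed.

End MeasurableRun.

(** * From mutual independence of the labelled sources to an iid family independent of the
    environment *)

Section Sources.
Context dO dE (Omega : measurableType dO) (E : measurableType dE) (R : realType)
  (P : probability Omega R).
Variables (d T M : nat) (W : Omega -> E).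
Variables (Z : nat -> 'I_d -> {RV P >-> R}) (Z' : nat -> nat -> 'I_d -> {RV P >-> R}).
Hypothesis mW : measurable_fun setT W.
Hypothesis hZ : forall t i, (t < T)%N -> std_exponential (Z t i).
Hypothesis hZ' : forall t k i, (t < T)%N -> (k < M)%N -> std_exponential (Z' t k i).
Hypothesis hind : mutually_independent P (used_label (d := d) T M)
  (source_sigma W Z Z').

Let J : finType := (('I_T * option 'I_M) * 'I_d)%type.

(** A finite type enumerating exactly the used labels, with [None] for the private randomness of the
    environment; [of_label] is a left inverse. *)
Definition label_of (j : option J) : source_label d :=
  match j with
  | None => inl (inl tt)
  | Some ((t, None), i) => inl (inr (val t, i))
  | Some ((t, Some k), i) => inr (val t, val k, i)
  end.

Definition of_label (l : source_label d) : option J :=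
  match l with
  | inl (inl _) => None
  | inl (inr (t, i)) => omap (fun t' => ((t', None), i)) (insub t)
  | inr (t, k, i) =>
      obind (fun t' => omap (fun k' => ((t', Some k'), i)) (insub k)) (insub t)
  end.

Lemma label_ofK : cancel label_of of_label.
Proof. by case=> [[[t [k|]] i]|] //=; rewrite !valK. Qed.

Definition source (j : J) : Omega -> R :=
  perturbation (T := T) (M := M) (fun t i w => Z t i w) (fun t k i w => Z' t k i w)
    j.1 j.2.

Lemma source_exponential j : exponential_var P (source j).
Proof.
case: j => -[t [k|]] i; rewrite /source /perturbation /=.
  split; first exact: measurable_funPT.
  by move=> B mB; rewrite -(hZ' i (ltn_ord t) (ltn_ord k) mB).
split; first exact: measurable_funPT.
by move=> B mB; rewrite -(hZ i (ltn_ord t) mB).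
Qed.

Lemma sources_independent (A : set E) (B : J -> set R) :
  measurable A -> (forall j, measurable (B j)) ->
  P (W @^-1` A `&` [set w | forall j, B j (source j w)]) =
  (prob P (W @^-1` A) * \prod_j prob P (source j @^-1` B j))%:E.
Proof.
move=> mA mB.
pose ev (j : option J) : set Omega :=
  if j is Some j' then source j' @^-1` B j' else W @^-1` A.
have mev j : measurable (ev j).
  case: j => [j|] /=; last exact: measurable_preimage.
  by have [mX _] := source_exponential j; exact: measurable_preimage.
(* Mutual independence is applied to the finite set of all used labels at once. *)
pose s := seq_fset tt [seq label_of j | j <- enum {: option J}].
have s_used : [set` s] `<=` used_label (d := d) T M.
  move=> l /=; rewrite seq_fsetE => /mapP[[[[t [k|]] i]|] _ ->] //=.
have ev_source l : l \in s -> source_sigma W Z Z' l (ev (of_label l)).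
   rewrite seq_fsetE => /mapP[j _ ->]; rewrite label_ofK.
  case: j => [[[t [k|]] i]|] /=.
  - by exists (B ((t, Some k), i)) => //; rewrite setTI.
  - by exists (B ((t, None), i)) => //; rewrite setTI.
  - by exists A => //; rewrite setTI.
have := hind s_used ev_source.
have -> : \bigcap_(l in [set` s]) ev (of_label l) =
    W @^-1` A `&` [set w | forall j, B j (source j w)].
  apply/seteqP; split=> w /=.
    move=> sw; have evw j : ev j w.
      have := sw (label_of j); rewrite label_ofK; apply.
      by rewrite /= seq_fsetE map_f// mem_enum.
    by split=> [|j]; [exact: (evw None)|exact: (evw (Some j))].
  move=> [Aw Bw] l /=; rewrite seq_fsetE => /mapP[j _ ->]; rewrite label_ofK.
  by case: j => [j|] //=; exact: Bw.
move=> ->.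
rewrite (perm_big _ (seq_fset_perm _ _)) undup_id; last first.
  by rewrite map_inj_uniq ?enum_uniq//; exact: (can_inj label_ofK).
rewrite big_map big_enum.
under eq_bigr do rewrite label_ofK (probE P (mev _)).
by rewrite prodEFin big_option.
Qed.

Lemma iid_source : iid_exponential P source.
Proof.
split=> [j|B mB]; first exact: source_exponential.
have := sources_independent measurableT mB.
by rewrite preimage_setT setTI /prob probability_setT mul1r.
Qed.

(** Passage from boxes to all measurable sets of perturbation vectors, by [rvec_law] with [c] the
    probability of the event about [W]. *)
Lemma sources_independent_rvec (A : set E) (B : set (rvec R J)) :
  measurable A -> measurable B ->
  P (W @^-1` A `&` (fun w j => source j w) @^-1` B) =
  (P (W @^-1` A) * P ((fun w j => source j w) @^-1` B))%E.
Proof.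
move=> mA mB; have mWA := measurable_preimage mW mA.
have mS := measurable_iid iid_source.
rewrite [X in (X * _)%E]probE//.
apply: (rvec_law (X := fun w j => source j w) (Y := fun w j => source j w)) => //.
  exact: prob_ge0.
move=> C mC; rewrite sources_independent// EFinM; congr (_ * _)%E.
by have [_ ->] := iid_source.
Qed.

End Sources.

Section RegretBound.
Context dO dE (Omega : measurableType dO) (E : measurableType dE) (R : realType)
  (P : probability Omega R).
Variables (d m T M : nat) (S : {set action d}) (eta : R).
Variables (W : Omega -> E) (env : E -> seq (action d) -> 'I_d -> R).
Variables (Z : nat -> 'I_d -> {RV P >-> R}) (Z' : nat -> nat -> 'I_d -> {RV P >-> R}).
Hypothesis m_bounds : (1 <= m <= d)%N.
Hypothesis T_gt0 : (1 <= T)%N.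
Hypothesis S_neq0 : S != finset.set0.
Hypothesis Sm : forall v, v \in S -> (l1norm v <= m)%N.
Hypothesis eta_gt0 : 0 < eta.
Hypothesis M_gt0 : (1 <= M)%N.
Hypothesis mW : measurable_fun setT W.
Hypothesis menv : forall h i, measurable_fun setT (fun x => env x h i).
Hypothesis env01 : forall x h i, 0 <= env x h i <= 1.
Hypothesis hZ : forall t i, (t < T)%N -> std_exponential (Z t i).
Hypothesis hZ' : forall t k i, (t < T)%N -> (k < M)%N -> std_exponential (Z' t k i).
Hypothesis hind : mutually_independent P (used_label (d := d) T M)
  (source_sigma W Z Z').

Let J : finType := (('I_T * option 'I_M) * 'I_d)%type.

(* Perturbations read off a vector indexed by the finitely many used labels;
   the others do not influence the first [T] rounds. *)
Let zof (y : J -> R) (t : nat) i : R :=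
  if insub t is Some t' then y ((t', None), i) else 0.

Let zof' (y : J -> R) (t k : nat) i : R :=
  if insub t is Some t' then
    if insub k is Some k' then y ((t', Some k'), i) else 0
  else 0.

Let src w j := source (T := T) (M := M) Z Z' j w.

Let zof_src w t i : (t < T)%N -> zof (src w) t i = Z t i w.
Proof. by move=> tT; rewrite /zof insubT. Qed.

Let zof'_src w t k i : (t < T)%N -> (k < M)%N -> zof' (src w) t k i = Z' t k i w.
Proof. by move=> tT kM; rewrite /zof' insubT insubT. Qed.

Lemma regret_bound :
  (fpl_gr_expected_regret S eta M W env Z Z' T <=
   (m%:R * (ln (d%:R / m%:R) + 1) / eta + 2 * eta * m%:R * d%:R * T%:R
    + d%:R * T%:R / (expR 1 * M%:R))%:E)%E.
Proof.
have /andP[m1 md] := m_bounds.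
have m0 : 0 < m%:R :> R by rewrite ltr0n.
have d0 : 0 < d%:R :> R by rewrite ltr0n (leq_trans m1).
have c0 : 0 <= ln (d%:R / m%:R) :> R.
  by rewrite ln_ge0// ler_pdivlMr// mul1r ler_nat.
rewrite /fpl_gr_expected_regret /expected_regret.
apply: (big_ind (fun x => x <= _)%E) => [|x y xC yC|u uS].
- exact: leNye.
- by rewrite ge_max xC.
rewrite unlock.
(* The regret becomes a function of two independent arguments, the private element of the
   environment and the vector of used perturbations. *)
pose f (xy : E * rvec R J) : R := history_regret (env xy.1) u
  (history M S eta (env xy.1) (zof xy.2) (zof' xy.2) T).
under eq_integral => w _.
  rewrite fpl_gr_regretE.
  rewrite (_ : history _ _ _ _ _ _ _ =
     history M S eta (env (W w)) (zof (src w)) (zof' (src w)) T); last first.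
    apply: history_ext => [t i tT|t k i tT kM]; first by rewrite zof_src.
    by rewrite zof'_src.
  rewrite -[history_regret _ _ _]/(f (W w, src w)).
  over.
have mcoord (j : J) : measurable_fun setT (fun xy : E * rvec R J => xy.2 j).
  by apply: (measurableT_comp (measurable_coord j)); exact: measurable_snd.
have iS := iid_source mW hZ hZ' hind.
apply: (integral_independent_le (Y := fun w => (src w : rvec R J)) mW
  (measurable_iid iS) _ (f := f) (k := (T * d)%:R)).
- by move=> A B mA mB; exact: (sources_independent_rvec mW hZ hZ' hind).
- apply: (@measurable_history_regret _ (E * rvec R J)%type R d M S eta
    (fun xy => env xy.1) (fun xy => zof xy.2) (fun xy => zof' xy.2)).
  + by move=> h i; apply: (measurableT_comp (menv h i)); exact: measurable_fst.
  + move=> t i; rewrite /zof; case: insubP => [t' _ _|_]; first exact: mcoord.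
    exact: measurable_cst.
  + move=> t k i; rewrite /zof'; case: insubP => [t' _ _|_]; last exact: measurable_cst.
    by case: insubP => [k' _ _|_]; [exact: mcoord|exact: measurable_cst].
- move=> [x y]; rewrite /f /=.
  have := history_regret_bound u (history M S eta (env x) (zof y) (zof' y) T) (env01 x).
  by rewrite (_ : size _ = T)//; elim: (T) => //= n ->.
move=> x; rewrite /f /=.
have iS' : iid_exponential P (fun bi : ('I_T * option 'I_M) * 'I_d =>
    perturbation (fun t i w => zof (src w) t i) (fun t k i w => zof' (src w) t k i)
      bi.1 bi.2).
  rewrite (_ : (fun bi => _) = source Z Z') //; apply/funext => -[[t [k|]] i].
    by apply/funext => w; rewrite /perturbation /= zof'_src.
  by apply/funext => w; rewrite /perturbation /= zof_src.
have run_le := run_regret S_neq0 eta_gt0 T_gt0 iS' M_gt0 Sm (env01 x) c0 uS.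
apply: le_trans; first exact: run_le.
rewrite lee_fin.
(* With [c = ln (d / m)] one has [d * expR (- c) = m], so the first term becomes
   [m * (c + 1) / eta]. *)
rewrite expRN lnK ?posrE ?divr_gt0// invf_div mulrCA divff ?gt_eqF// mulr1.
by rewrite le_eqVlt; apply/orP; left; apply/eqP; ring.
Qed.

End RegretBound.

(** * The tuned choice of [eta] and [M] *)

Lemma tuned_bound (R : realType) (d m T M : nat) (eta c : R) :
  (0 < m)%N -> (0 < d)%N -> (0 < T)%N -> (0 < M)%N -> 0 < eta -> 0 < c ->
  eta = Num.sqrt (c / (2 * d%:R * T%:R)) ->
  M%:Z = Num.ceil (Num.sqrt (d%:R * T%:R)
                    / (expR 1 * m%:R * Num.sqrt (2 * c))) ->
  m%:R * c / eta + 2 * eta * m%:R * d%:R * T%:R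
    + d%:R * T%:R / (expR 1 * M%:R) <= 3 * m%:R * Num.sqrt (2 * d%:R * T%:R * c).
Proof.
rewrite -!(ltr0n R) => m0 d0 T0 M0 eta0 c0 etaE ME.
(* Each of the three terms is compared with [m * s]: the first two equal it because [eta * s = c],
   and the third is at most that. *)
set s := Num.sqrt (2 * d%:R * T%:R * c).
have dT0 : 0 < d%:R * T%:R :> R by rewrite mulr_gt0.
have s2 : s ^+ 2 = 2 * d%:R * T%:R * c by rewrite sqr_sqrtr// !mulr_ge0// ltW.
have s0 : 0 < s by rewrite sqrtr_gt0 !mulr_gt0.
have etas : eta * s = c.
  rewrite etaE /s -sqrtrM ?divr_ge0 ?mulr_ge0 ?ltW//.
  rewrite mulrA divfK ?gt_eqF ?mulr_gt0// -expr2 sqrtr_sqr gtr0_norm//.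
have E1 : m%:R * c / eta = m%:R * s by rewrite -etas; field; rewrite gt_eqF.
have E2 : 2 * eta * m%:R * d%:R * T%:R = m%:R * s.
  have : (2 * eta * d%:R * T%:R) * s = s * s.
    by rewrite -expr2 s2 -etas; ring.
  move/(mulIf (lt0r_neq0 s0)) => <-; ring.
set a := Num.sqrt (d%:R * T%:R) in ME; set b := Num.sqrt (2 * c) in ME.
have a0 : 0 < a by rewrite sqrtr_gt0.
have b0 : 0 < b by rewrite sqrtr_gt0 mulr_gt0.
have a2 : d%:R * T%:R = a * a by rewrite -expr2 sqr_sqrtr// ltW.
have sE : s = a * b.
  by rewrite /s /a /b -sqrtrM ?ltW//; congr Num.sqrt; ring.
have e0 : 0 < expR 1 :> R by exact: expR_gt0.
(* The ceiling enters only through this lower bound on [M]. Together with [s = a * b] it gives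
   [d T / (e M) <= m s]. *)
have aM : a <= M%:R * (expR 1 * m%:R * b).
  rewrite -ler_pdivrMr ?mulr_gt0//.
  by have := Num.Theory.ceil_ge (a / (expR 1 * m%:R * b)); rewrite -ME.
have E3 : d%:R * T%:R / (expR 1 * M%:R) <= m%:R * s.
  rewrite ler_pdivrMr ?mulr_gt0// a2 sE.
  rewrite (_ : _ * _ * _ = a * (M%:R * (expR 1 * m%:R * b))); last by ring.
  by rewrite ler_wpM2l// ltW.
rewrite E1 E2; lra.
Qed.

Theorem theorem1 (R : realType) (d m T : nat)
    (hm : (1 <= m <= d)%N) (hT : (1 <= T)%N)
    (S : {set action d}) (hS0 : S != finset.set0)
    (hSm : forall v, v \in S -> (l1norm v <= m)%N)
    (eta : R) (M : nat) (heta : 0 < eta) (hM : (1 <= M)%N)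
    (dO dE : measure_display) (Omega : measurableType dO)
    (E : measurableType dE) (P : probability Omega R)
    (W : Omega -> E) (hW : measurable_fun setT W)
    (env : E -> seq (action d) -> 'I_d -> R)
    (henv_meas : forall h i, measurable_fun setT (fun x => env x h i))
    (henv_bound : forall x h i, 0 <= env x h i <= 1)
    (Z : nat -> 'I_d -> {RV P >-> R})
    (Z' : nat -> nat -> 'I_d -> {RV P >-> R})
    (hZ : forall t i, (t < T)%N -> std_exponential (Z t i))
    (hZ' : forall t k i, (t < T)%N -> (k < M)%N -> std_exponential (Z' t k i))
    (hind : mutually_independent P (used_label (d := d) T M)
              (source_sigma W Z Z')) :
  let c := ln (d%:R / m%:R) + 1 : R in
  let regret := fpl_gr_expected_regret S eta M W env Z Z' T in
  (regret <= (m%:R * c / eta + 2 * eta * m%:R * d%:R * T%:R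
              + d%:R * T%:R / (expR 1 * M%:R))%:E)%E /\
  (eta = Num.sqrt (c / (2 * d%:R * T%:R)) ->
   M%:Z = Num.ceil (Num.sqrt (d%:R * T%:R)
                    / (expR 1 * m%:R * Num.sqrt (2 * c))) ->
   (regret <= (3 * m%:R * Num.sqrt (2 * d%:R * T%:R * c))%:E)%E).
Proof.
move=> c regret; have /andP[m1 md] := hm.
have bound := regret_bound hm hT hS0 hSm heta hM hW henv_meas henv_bound hZ hZ' hind.
split=> // etaE ME; apply: (le_trans bound); rewrite lee_fin.
apply: tuned_bound => //; first exact: (leq_trans m1).
rewrite ltr_wpDl// ln_ge0// ler_pdivlMr ?ltr0n// mul1r ler_nat.
exact: md.
Qed.
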